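(* Let $\boldsymbol\mu=\{\mu_\beta\}_{\beta\in\mathbb F_n^+}$ be a sequence of strictly positive real numbers with $\mu_{g_0}=1$ and $\sup_{\alpha\in\mathbb F_n^+,\,i\in\{1,\ldots,n\}}\mu_{g_i\alpha}<\infty$, let $F^2(\boldsymbol\mu)$ be the Hilbert space of formal power series in indeterminates $Z_1,\ldots,Z_n$ associated with $\boldsymbol\mu$, and let $L_Z=(L_{Z_1},\ldots,L_{Z_n})$ be the left multi-shift associated with $\boldsymbol\mu$. Then the following statements hold. (i) $$\mathcal D(\boldsymbol\mu)=\Big\{(\lambda_1,\ldots,\lambda_n)\in\mathbb C^n:\ \sum_{\alpha\in\mathbb F_n^+}\frac{|\lambda_\alpha|^2}{\boldsymbol\mu(\alpha,g_0)^2}<\infty\Big\}=\sigma_p(L_{Z_1}^*,\ldots,L_{Z_n}^* ).$$ (ii) If $\lambda\in\mathcal D(\boldsymbol\mu)$ and $f=\sum_{\alpha\in\mathbb F_n^+}c_\alpha Z_\alpha\in F^2(\boldsymbol\mu)$, then the series $f(\lambda):=\sum_{\alpha\in\mathbb F_n^+}c_\alpha\lambda_\alpha$ is absolutely convergent to $\varphi_\lambda(f)$ and $$|f(\lambda)|\le\|f\|_{\boldsymbol\mu}\Big(\sum_{\alpha\in\mathbb F_n^+}\frac{|\lambda_\alpha|^2}{\boldsymbol\mu(\alpha,g_0)^2}\Big)^{1/2}.$$ (iii) If $\lambda\in\mathbb C^n$ and the series $\sum_{k=0}^\infty\sum_{|\alpha|=k}c_\alpha\lambda_\alpha$ is convergent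 for every $f=\sum_{\alpha\in\mathbb F_n^+}c_\alpha Z_\alpha\in F^2(\boldsymbol\mu)$, then $\lambda\in\mathcal D(\boldsymbol\mu)$. (iv) If $\varphi=\sum_{\alpha\in\mathbb F_n^+}c_\alpha Z_\alpha$ is a bounded free holomorphic function on the open ball of $B(\mathcal H)^n$ of radius $\|L_Z\|$, then $\varphi\in\mathcal M^\ell(F^2(\boldsymbol\mu))$ and $$\|L_\varphi\|=\|\varphi(L_{Z_1},\ldots,L_{Z_n})\|\le\sup\{\|\varphi(X_1,\ldots,X_n)\|:\ \|(X_1,\ldots,X_n)\|<\|L_Z\|\}.$$
   Context: $\mathbb F_n^+$ is the unital free semigroup on generators $g_1,\ldots,g_n$ with identity $g_0$; $|\alpha|$ is the length of $\alpha$. For $\alpha=g_{i_1}\cdots g_{i_k}$: $Z_\alpha:=Z_{i_1}\cdots Z_{i_k}$, $\lambda_\alpha:=\lambda_{i_1}\cdots\lambda_{i_k}$, $X_\alpha:=X_{i_1}\cdots X_{i_k}$, and $\boldsymbol\mu(\alpha,g_0):=\mu_{g_{i_1}\cdots g_{i_k}}\mu_{g_{i_2}\cdots g_{i_k}}\cdots\mu_{g_{i_k}}$; also $\lambda_{g_0}:=1$, $Z_{g_0}:=1$, $X_{g_0}:=I$, $\boldsymbol\mu(g_0,g_0):=1$. $F^2(\boldsymbol\mu)$ is the Hilbert space of formal power series $\zeta=\sum_\alpha c_\alpha Z_\alpha$ in noncommuting indeterminates with $\|\zeta\|_{\boldsymbol\mu}^2:=\sum_\alpha\boldsymbol\mu(\alpha,g_0)^2|c_\alpha|^2<\infty$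 (the $Z_\alpha$ being orthogonal). $L_{Z_i}\zeta:=Z_i\zeta$, a bounded operator. $\varphi_\lambda:\mathbb C\langle Z_1,\ldots,Z_n\rangle\to\mathbb C$, $\varphi_\lambda(p):=p(\lambda)$; $\mathcal D(\boldsymbol\mu)$ is the set of $\lambda\in\mathbb C^n$ for which $\varphi_\lambda$ extends to a bounded linear functional (still denoted $\varphi_\lambda$) on $F^2(\boldsymbol\mu)$. The joint point spectrum $\sigma_p(L_{Z_1}^*,\ldots,L_{Z_n}^* )$ is the set of $\zeta\in\mathbb C^n$ for which there is $z\in F^2(\boldsymbol\mu)$, $z\ne0$, with $L_{Z_i}^*z=\zeta_iz$ for all $i$. A formal power series $\varphi=\sum_\alpha c_\alpha Z_\alpha$ is a left multiplier, $\varphi\in\mathcal M^\ell(F^2(\boldsymbol\mu))$, if the formal product $\varphi\zeta$ belongs to $F^2(\boldsymbol\mu)$ for all $\zeta\in F^2(\boldsymbol\mu)$; then $L_\varphi\zeta:=\varphi\zeta$ is a bounded operator. $\varphi(L_{Z_1},\ldots,L_{Z_n})$ denotes the bounded operator on $F^2(\boldsymbol\mu)$ extending $p\mapsto\sum_\alpha c_\alpha L_{Z_\alpha}p$ from polynomials $p$, where $L_{Z_\alpha}=L_{Z_{i_1}}\cdots L_{Z_{i_k}}$. For an $n$-tuple, $\|(X_1,\ldots,X_n)\|:=\|\sum_iX_iX_i^*\|^{1/2}$. $\mathcal H$ is a separable infinite-dimensional Hilbert space. $\varphi$ is free holomorphic on the open ball of radius $\rho$ if $\varphi(X):=\sum_{k=0}^\infty\sum_{|\alpha|=k}c_\alpha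 X_\alpha$ converges in norm whenever $\|(X_1,\ldots,X_n)\|<\rho$ (for operators on any Hilbert space), and it is bounded if $\sup\|\varphi(X)\|<\infty$ over that ball. *)

(* Defs.v *)
From HB Require Import structures.
From mathcomp Require Import all_boot all_order all_algebra.
From mathcomp Require Import all_classical all_reals all_analysis.
From mathcomp Require Import complex.
From mathcomp Require Import ring lra.
Set Implicit Arguments.
Unset Strict Implicit.
Unset Printing Implicit Defensive.
Import Order.TTheory GRing.Theory Num.Theory.
Import numFieldNormedType.Exports.
Import ComplexField.Normc.
Local Open Scope classical_set_scope.
Local Open Scope complex_scope.
Local Open Scope ring_scope.

HB.mixin Record NormedModule_hasInner (R : realType) V
    of NormedModule R[i] V := {
  inner : V -> V -> R[i];
  innerP : forall (a : R[i]) (x y z : V),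
    inner (a *: x + y) z = a * inner x z + inner y z;
  innerC : forall x y : V, inner y x = (inner x y)^*;
  innerE : forall x : V, inner x x = `|x| ^+ 2
}.

#[short(type="hilbertType")]
HB.structure Definition Hilbert (R : realType) :=
  {V of CompleteNormedModule R[i] V & NormedModule_hasInner R V}.

Notation word n := (seq 'I_n).

(* [:: i1; ...; ik] is the word g_i1 ... g_ik, and [::] is the identity *)
Record weight (R : realType) (n : nat) := Weight {
  weight_val :> word n -> R;
  weight_gt0 : forall a, 0 < weight_val a;
  weight_nil : weight_val [::] = 1;
  weight_bounded : exists M : R, forall i a, weight_val (i :: a) <= M }.

Fixpoint wprod (R : realType) (n : nat) (mu : weight R n) (a : word n) : R :=
  if a is i :: b then mu (i :: b) * wprod mu b else 1.

Definition wsum (V : nmodType) (n : nat) (c : word n -> V) (N : nat) : V :=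
  \sum_(k < N) \sum_(a : k.-tuple 'I_n) c a.

(* R[i]^o is the complex field with its topology and norm *)
Definition fps (R : realType) (n : nat) := word n -> R[i]^o.
HB.instance Definition _ (R : realType) (n : nat) :=
  GRing.Lmodule.copy (fps R n) (word n -> R[i]^o).

Definition fsmul (R : realType) (n : nat) (f g : fps R n) : fps R n :=
  fun a => \sum_(k < (size a).+1) (f (take k a) : R[i]) * g (drop k a).

Definition Zvar (R : realType) (n : nat) (i : 'I_n) : fps R n :=
  fun a => (a == [:: i])%:R.

Definition sqnorm (R : realType) (n : nat) (mu : weight R n) (f : fps R n)
    : \bar R :=
  \esum_(a in [set: word n]) (wprod mu a ^+ 2 * normc (f a) ^+ 2)%:E.

Definition sqsum (R : realType) (n : nat) (mu : weight R n) : {pred fps R n} :=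
  fun f => `[< (sqnorm mu f < +oo)%E >].

Record F2 (R : realType) (n : nat) (mu : weight R n) := F2_of {
  F2_val :> fps R n;
  F2_valP : F2_val \in sqsum mu }.

Section F2_module.
Context (R : realType) (n : nat) (mu : weight R n).
Implicit Types f g : fps R n.

HB.instance Definition _ := [isSub for @F2_val R n mu].
HB.instance Definition _ := gen_eqMixin (F2 mu).
HB.instance Definition _ := gen_choiceMixin (F2 mu).

Lemma normcge0 (x : R[i]) : 0 <= normc x.
Proof. by case: x => a b; exact: sqrtr_ge0. Qed.

Lemma sqsumP f : reflect (sqnorm mu f < +oo)%E (f \in sqsum mu).
Proof. by apply: (iffP idP); rewrite unfold_in => /asboolP. Qed.

Lemma wprod_gt0 a : 0 < wprod mu a.
Proof. by elim: a => //= i a ih; rewrite mulr_gt0// weight_gt0. Qed.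

Lemma esum_le_scale (T : choiceType) (u : T -> R) (r : R) : 0 <= r ->
  (forall a, 0 <= u a) ->
  (\esum_(a in [set: T]) (r * u a)%:E <=
     r%:E * \esum_(a in [set: T]) (u a)%:E)%E.
Proof.
move=> r0 u0; apply: ge_ereal_sup => _ [X [finX _] <-].
under eq_fsbigr do rewrite EFinM.
rewrite -ge0_mule_fsumr; last by move=> a; rewrite lee_fin.
by apply: lee_wpmul2l; rewrite ?lee_fin//; apply: esum_ge; exists X.
Qed.

Lemma term_ge0 f a : 0 <= wprod mu a ^+ 2 * normc (f a) ^+ 2.
Proof. by apply: mulr_ge0; exact: sqr_ge0. Qed.

Lemma sqnorm_ge0 f : (0 <= sqnorm mu f)%E.
Proof.
by apply: esum_ge0 => a _; rewrite lee_fin term_ge0.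
Qed.

Lemma sqnorm_scale_le (c : R[i]) f :
  (sqnorm mu (c *: f)%R <= (normc c ^+ 2)%:E * sqnorm mu f)%E.
Proof.
have -> : sqnorm mu (c *: f) = \esum_(a in [set: word n])
    (normc c ^+ 2 * (wprod mu a ^+ 2 * normc (f a) ^+ 2))%:E.
  apply: eq_esum => a _; congr (_%:E).
  have -> : (c *: f) a = c * f a by [].
  by rewrite normcM; ring.
by apply: esum_le_scale => [|a]; [exact: sqr_ge0|exact: term_ge0].
Qed.

Lemma sqnorm_add_le (p q : R) f g : 0 < p -> 0 < q ->
  (sqnorm mu (f + g)%R <= ((p + q) / p)%:E * sqnorm mu f
                        + ((p + q) / q)%:E * sqnorm mu g)%E.
Proof.
move=> p0 q0.
have pq0 : 0 < p + q by rewrite addr_gt0.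
have H (r : R) (h : fps R n) : 0 < r ->
    (\esum_(a in [set: word n]) (r * (wprod mu a ^+ 2 * normc (h a) ^+ 2))%:E
     <= r%:E * sqnorm mu h)%E.
  move=> r0.
  by apply: esum_le_scale => [|a]; [exact: ltW|exact: term_ge0].
apply: (le_trans _ (leeD (H _ _ _) (H _ _ _))); rewrite ?divr_gt0//.
rewrite -esumD; first last.
- move=> a _; rewrite lee_fin mulr_ge0 ?term_ge0//.
  by rewrite divr_ge0// ltW.
- move=> a _; rewrite lee_fin mulr_ge0 ?term_ge0//.
  by rewrite divr_ge0// ltW.
apply: le_esum => a _; rewrite -EFinD lee_fin.
have -> : (f + g) a = (f a : R[i]) + g a by [].
have := le_normcD (f a) (g a).
have := normcge0 (f a).
have := normcge0 (g a).
have := normcge0 ((f a : R[i]) + g a).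
set x := normc _; set y := normc _; set z := normc _ => x0 y0 z0 xyz.
have -> : (p + q) / p * (wprod mu a ^+ 2 * z ^+ 2)
   + (p + q) / q * (wprod mu a ^+ 2 * y ^+ 2) = wprod mu a ^+ 2 *
   ((p + q) * (z ^+ 2 / p + y ^+ 2 / q)) by ring.
apply: ler_wpM2l; first exact: sqr_ge0.
apply: (@le_trans _ _ ((z + y) ^+ 2)).
  by rewrite ler_sqr// ?nnegrE ?addr_ge0.
rewrite -subr_ge0.
have -> : (p + q) * (z ^+ 2 / p + y ^+ 2 / q) - (z + y) ^+ 2 =
  (q * z - p * y) ^+ 2 / (p * q).
  by field; rewrite !gt_eqF.
by rewrite divr_ge0 ?sqr_ge0// mulr_ge0// ltW.
Qed.

Lemma sqnorm0 : sqnorm mu 0 = 0%E.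
Proof.
by apply: esum1 => a _; rewrite [X in normc X](_ : _ = 0)// normc0 expr0n mulr0.
Qed.

Fact sqsum_submod_closed : submod_closed (sqsum mu).
Proof.
split; first by apply/sqsumP; rewrite sqnorm0.
move=> c f g /sqsumP foo /sqsumP goo; apply/sqsumP.
apply: (le_lt_trans (sqnorm_add_le _ _ ltr01 ltr01)).
apply: lte_add_pinfty; apply: lte_mul_pinfty; rewrite ?lee_fin ?divr_ge0//.
apply: (le_lt_trans (sqnorm_scale_le _ _)).
by apply: lte_mul_pinfty; rewrite ?lee_fin ?sqr_ge0.
Qed.
HB.instance Definition _ :=
  GRing.isSubmodClosed.Build R[i] (fps R n) (sqsum mu) sqsum_submod_closed.
HB.instance Definition _ :=
  [SubChoice_isSubLmodule of F2 mu by <:].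

End F2_module.

Section F2_norm.
Context (R : realType) (n : nat) (mu : weight R n).

Definition nrmF2 (f : F2 mu) : R := Num.sqrt (fine (sqnorm mu f)).

Lemma sqnorm_fin (f : F2 mu) : sqnorm mu f \is a fin_num.
Proof.
by rewrite ge0_fin_numE ?sqnorm_ge0//; apply/sqsumP; exact: F2_valP.
Qed.

Lemma nrmF2_ge0 f : 0 <= nrmF2 f. Proof. exact: sqrtr_ge0. Qed.

Lemma sqr_nrmF2 (f : F2 mu) : (nrmF2 f ^+ 2)%:E = sqnorm mu f.
Proof. by rewrite sqr_sqrtr ?fine_ge0 ?sqnorm_ge0// fineK// sqnorm_fin. Qed.

Lemma term_le_sqnorm (f : fps R n) a :
  ((wprod mu a ^+ 2 * normc (f a) ^+ 2)%:E <= sqnorm mu f)%E.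
Proof.
apply: esum_ge; exists [set a]; first by split=> //; exact: finite_set1.
by rewrite fsbig_set1.
Qed.

Lemma le_nrmF2 (f : F2 mu) (r : R) : 0 <= r ->
  (sqnorm mu f <= (r ^+ 2)%:E)%E = (nrmF2 f <= r).
Proof.
by move=> r0; rewrite -sqr_nrmF2 lee_fin ler_sqr// nnegrE nrmF2_ge0.
Qed.

Lemma coef_le_nrmF2 (f : F2 mu) a : wprod mu a * normc (F2_val f a) <= nrmF2 f.
Proof.
rewrite -ler_sqr ?nnegrE ?nrmF2_ge0 ?mulr_ge0 ?normcge0 ?(ltW (wprod_gt0 _ _))//.
by rewrite -lee_fin sqr_nrmF2 exprMn term_le_sqnorm.
Qed.

Lemma nrmF2_eq0 f : nrmF2 f = 0 -> f = 0.
Proof.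
move=> f0; apply: val_inj; apply/funext => a /=.
apply: eq0_normc; apply/eqP; rewrite eq_le normcge0 andbT.
by have := coef_le_nrmF2 f a; rewrite f0 pmulr_rle0// wprod_gt0.
Qed.

Lemma nrmF2D f g : nrmF2 (f + g) <= nrmF2 f + nrmF2 g.
Proof.
have [->|f0] := eqVneq f 0; first by rewrite add0r lerDr nrmF2_ge0.
have [->|g0] := eqVneq g 0; first by rewrite addr0 lerDl nrmF2_ge0.
have P h : h != 0 -> 0 < nrmF2 h.
  by move=> h0; rewrite lt_def nrmF2_ge0 andbT; apply: contra_neq h0 => /nrmF2_eq0.
rewrite -le_nrmF2 ?addr_ge0 ?nrmF2_ge0//.
apply: (le_trans (sqnorm_add_le _ _ _ (P _ f0) (P _ g0))).
rewrite -!sqr_nrmF2 -!EFinM -EFinD lee_fin le_eqVlt; apply/orP; left; apply/eqP.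
by field; rewrite !gt_eqF ?P.
Qed.

Lemma nrmF2Z_le (c : R[i]) f : nrmF2 (c *: f) <= normc c * nrmF2 f.
Proof.
rewrite -le_nrmF2 ?mulr_ge0 ?nrmF2_ge0 ?normcge0//.
apply: (le_trans (sqnorm_scale_le _ _ _)).
by rewrite -sqr_nrmF2 -EFinM -exprMn.
Qed.

Lemma nrmF2Z (c : R[i]) f : nrmF2 (c *: f) = normc c * nrmF2 f.
Proof.
apply/eqP; rewrite eq_le nrmF2Z_le /=.
have [->|c0] := eqVneq c 0; first by rewrite normc0 mul0r nrmF2_ge0.
rewrite -[f in leLHS](scalerK c0) (le_trans (ler_wpM2l _ (nrmF2Z_le _ _)))//.
  exact: normcge0.
by rewrite mulrA -normcM divff// normc1 mul1r.
Qed.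

Definition normF2 f : R[i] := (nrmF2 f)%:C.

Fact normF2D f g : normF2 (f + g) <= normF2 f + normF2 g.
Proof. by rewrite /normF2 -rmorphD lecR nrmF2D. Qed.

Fact normF2Z (c : R[i]) f : normF2 (c *: f) = `|c| * normF2 f.
Proof. by rewrite /normF2 nrmF2Z rmorphM. Qed.

Fact normF2_eq0 f : normF2 f = 0 -> f = 0.
Proof. by case=> /nrmF2_eq0. Qed.

HB.instance Definition _ :=
  Lmodule_isNormed.Build R[i] (F2 mu) normF2D normF2Z normF2_eq0.

Lemma normF2E (f : F2 mu) : `|f| = (nrmF2 f)%:C.
Proof. by []. Qed.

End F2_norm.

Section wsum_theory.
Context (R : realType) (n : nat).
Implicit Types (u v : word n -> R).

Fixpoint words_lt (N : nat) : seq (word n) :=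
  if N is m.+1 then words_lt m ++ map val (enum {: m.-tuple 'I_n}) else [::].

Lemma mem_words_lt N a : (a \in words_lt N) = (size a < N)%N.
Proof.
elim: N => [|N ih] //=; rewrite mem_cat ih ltnS [RHS]leq_eqVlt [RHS]orbC; congr (_ || _).
apply/mapP/eqP => [[t _ ->]|<-]; first exact: size_tuple.
by exists (in_tuple a) => //; rewrite mem_enum.
Qed.

Lemma uniq_words_lt N : uniq (words_lt N).
Proof.
elim: N => [|N ih] //=; rewrite cat_uniq ih map_inj_uniq ?enum_uniq ?andbT/=.
  apply/hasPn => _ /mapP[t _ ->].
  by rewrite mem_words_lt size_tuple ltnn.
exact: val_inj.
Qed.

Lemma wsumE (V : nmodType) (c : word n -> V) N :
  wsum c N = \sum_(a <- words_lt N) c a.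
Proof.
rewrite /wsum; elim: N => [|N ih]; first by rewrite big_ord0 big_nil.
by rewrite big_ord_recr /= ih big_cat big_map big_enum.
Qed.

Arguments words_lt : simpl never.

Lemma wsum_le_esum u N : (forall a, 0 <= u a) ->
  ((wsum u N)%:E <= \esum_(a in [set: word n]) (u a)%:E)%E.
Proof.
move=> u0; apply: esum_ge; exists [set` words_lt N].
  by split=> //; exact: finite_seq.
by rewrite -fsbig_seq ?uniq_words_lt// sumEFin -wsumE.
Qed.

Lemma fsum_le_wsum u (X : set (word n)) : finite_set X -> (forall a, 0 <= u a) ->
  exists N, (\sum_(a \in X) (u a)%:E <= (wsum u N)%:E)%E.
Proof.
move=> /[dup] finX /finite_seqP[s Xs] u0; exists (\max_(a <- s) size a).+1.
rewrite wsumE -sumEFin (@fsbig_seq _ _ _ _ (words_lt _)) ?uniq_words_lt//.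
apply: lee_fsum_nneg_subset => //.
  move=> a; rewrite Xs !inE/= mem_words_lt ltnS => sa.
  exact: leq_bigmax_seq.
by move=> a _; rewrite lee_fin.
Qed.

Lemma nondecreasing_wsum u : (forall a, 0 <= u a) ->
  nondecreasing_seq (wsum u).
Proof.
move=> u0; apply/nondecreasing_seqP => N.
by rewrite /wsum big_ord_recr /= lerDl sumr_ge0.
Qed.

Lemma wsum_cvg_esum u : (forall a, 0 <= u a) ->
  (\esum_(a in [set: word n]) (u a)%:E < +oo)%E ->
  wsum u @ \oo --> fine (\esum_(a in [set: word n]) (u a)%:E).
Proof.
move=> u0 uoo.
have ufin : \esum_(a in [set: word n]) (u a)%:E \is a fin_num.
  by rewrite ge0_fin_numE// esum_ge0// => a _; rewrite lee_fin.
have ub N : wsum u N <= fine (\esum_(a in [set: word n]) (u a)%:E).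
  by rewrite -lee_fin fineK// wsum_le_esum.
have cu : cvgn (wsum u).
  apply: nondecreasing_is_cvgn; first exact: nondecreasing_wsum.
  by exists (fine (\esum_(a in [set: word n]) (u a)%:E)) => _ [N _ <-].
suff <- : limn (wsum u) = fine (\esum_(a in [set: word n]) (u a)%:E) by [].
apply/eqP; rewrite eq_le; apply/andP; split.
  by apply: limr_le => //; near=> N.
rewrite -lee_fin fineK//; apply: ge_ereal_sup => _ [X [finX _] <-].
have [N /le_trans->//] := fsum_le_wsum finX u0.
rewrite lee_fin; apply: nondecreasing_cvgn_le => //.
exact: nondecreasing_wsum.
Unshelve. all: by end_near. Qed.

Lemma is_cvg_wsum u v : (forall a, `|u a| <= v a) ->
  (\esum_(a in [set: word n]) (v a)%:E < +oo)%E -> cvgn (wsum u).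
Proof.
move=> uv voo.
have v0 a : 0 <= v a by exact: le_trans (uv a).
pose w a := u a + v a.
have w0 a : 0 <= w a.
  by have := uv a; rewrite ler_norml /w -lerBlDr sub0r => /andP[].
have cw : cvgn (wsum w).
  apply: cvgP; apply: wsum_cvg_esum => //.
  have H : (\esum_(a in [set: word n]) (v a + v a)%:E < +oo)%E.
    under eq_esum do rewrite EFinD.
    by rewrite esumD ?lte_add_pinfty// => a _; rewrite lee_fin.
  apply: le_lt_trans H; apply: le_esum => a _; rewrite lee_fin lerD2r.
  exact: le_trans (ler_norm _) (uv a).
have cv : cvgn (wsum v) by apply: cvgP; exact: wsum_cvg_esum.
have -> : wsum u = wsum w - wsum v.
  apply/funext => N; rewrite !fctE !wsumE -sumrB.
  by apply: eq_bigr => a _; rewrite addrK.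
exact: is_cvgB.
Qed.

End wsum_theory.

Section complex_limits.
Context (R : realType).

Lemma cvg_complex (a b : nat -> R) (la lb : R) :
  a @ \oo --> la -> b @ \oo --> lb ->
  (fun N => a N +i* b N : R[i]^o) @ \oo --> (la +i* lb : R[i]^o).
Proof.
move=> ala blb; apply/cvgrPdist_lt => -[e e'].
rewrite ltcE /= => /andP[/eqP -> e0].
have e20 : 0 < e / 2 by rewrite divr_gt0.
move/cvgrPdist_lt : ala => /(_ _ e20) Ha.
move/cvgrPdist_lt : blb => /(_ _ e20) Hb.
near=> N.
have hA : `|la - a N| < e / 2 by near: N.
have hB : `|lb - b N| < e / 2 by near: N.
have -> : la +i* lb - (a N +i* b N) =
  (la - a N) +i* 0 + (0 +i* (lb - b N)) :> R[i] by simpc.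
apply: (le_lt_trans (ler_normD _ _)).
rewrite ltcE /= addr0 eqxx /= !expr0n /= addr0 add0r !sqrtr_sqr.
by rewrite [e]splitr ltrD.
Unshelve. all: by end_near. Qed.

Lemma cvg_conjc (u : nat -> R[i]^o) (l : R[i]^o) :
  u @ \oo --> l -> (fun N => (u N)^* : R[i]^o) @ \oo --> (l^* : R[i]^o).
Proof.
move=> /cvgrPdist_lt ul; apply/cvgrPdist_lt => e /ul; apply: filterS => N.
by rewrite -rmorphB normcJ.
Qed.

Lemma wsum_complex n (c : word n -> R[i]) N :
  wsum c N = wsum (@complex.Re R \o c) N +i* wsum (@complex.Im R \o c) N.
Proof.
rewrite !wsumE; elim: (words_lt n N) => [|a s ih]; first by rewrite !big_nil.
by rewrite !big_cons ih /=; case: (c a).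
Qed.

Lemma normc_ge_Re' (z : R[i]) : `|complex.Re z| <= normc z.
Proof. by rewrite -lecR; exact: normc_ge_Re. Qed.

Lemma normc_ge_Im (z : R[i]) : `|complex.Im z| <= normc z.
Proof.
case: z => a b /=; rewrite -sqrtr_sqr ler_sqrt ?addr_ge0 ?sqr_ge0//.
by rewrite lerDr sqr_ge0.
Qed.

Lemma sqr_normc2 (z : R[i]) :
  normc z ^+ 2 = complex.Re z ^+ 2 + complex.Im z ^+ 2.
Proof. by case: z => a b /=; rewrite sqr_sqrtr ?addr_ge0 ?sqr_ge0. Qed.

Lemma is_cvg_wsumC n (c : word n -> R[i]^o) (v : word n -> R) :
  (forall a, normc (c a) <= v a) ->
  (\esum_(a in [set: word n]) (v a)%:E < +oo)%E -> cvgn (wsum c).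
Proof.
move=> cv voo.
have /cvg_ex[/= l1 Hl1] : cvgn (wsum (@complex.Re R \o (c : word n -> R[i]))).
  apply: is_cvg_wsum voo => a; exact: le_trans (normc_ge_Re' _) (cv a).
have /cvg_ex[/= l2 Hl2] : cvgn (wsum (@complex.Im R \o (c : word n -> R[i]))).
  apply: is_cvg_wsum voo => a; exact: le_trans (normc_ge_Im _) (cv a).
have := cvg_complex Hl1 Hl2.
rewrite (_ : (fun N => _) = wsum c); first by move=> /cvgP.
by apply/funext => N; rewrite -wsum_complex.
Qed.

End complex_limits.

Section F2_hilbert.
Context (R : realType) (n : nat) (mu : weight R n).
Implicit Types f g h : F2 mu.

Definition innerF2_term f g (a : word n) : R[i]^o :=
  (wprod mu a ^+ 2)%:C * F2_val f a * (F2_val g a)^*.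

Definition innerF2 f g : R[i] := limn (wsum (innerF2_term f g)).

Lemma normcJ_R (z : R[i]) : normc z^* = normc z.
Proof. by case: z => a b /=; rewrite sqrrN. Qed.

Lemma normc_real (r : R) : normc r%:C = `|r|.
Proof. by rewrite /= expr0n /= addr0 sqrtr_sqr. Qed.

Lemma is_cvg_innerF2 f g : cvgn (wsum (innerF2_term f g)).
Proof.
apply: (@is_cvg_wsumC _ _ _ (fun a => wprod mu a ^+ 2 * normc (F2_val f a) ^+ 2
   + wprod mu a ^+ 2 * normc (F2_val g a) ^+ 2)) => [a|].
  rewrite !normcM normcJ_R normc_real ger0_norm ?sqr_ge0// -mulrA -mulrDr.
  rewrite ler_wpM2l ?sqr_ge0//.
  set x := normc _; set y := normc _.
  have x0 : 0 <= x by exact: normcge0.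
  have y0 : 0 <= y by exact: normcge0.
  by nra.
under eq_esum do rewrite EFinD.
rewrite esumD; try by move=> a _; rewrite lee_fin term_ge0.
by apply: lte_add_pinfty; apply/sqsumP; exact: F2_valP.
Qed.

Lemma innerF2_cvg f g :
  wsum (innerF2_term f g) @ \oo --> (innerF2 f g : R[i]^o).
Proof. exact: is_cvg_innerF2. Qed.

Fact innerF2P (c : R[i]) f g h :
  innerF2 (c *: f + g) h = c * innerF2 f h + innerF2 g h.
Proof.
apply: (@cvg_lim R[i]^o) => //.
rewrite (_ : wsum _ = fun N => (c : R[i]^o) *: wsum (innerF2_term f h) N
                               + wsum (innerF2_term g h) N).
  apply: cvgD; last exact: innerF2_cvg.
  by apply: cvgZl_tmp; exact: innerF2_cvg.
apply/funext => N; rewrite !wsumE scaler_sumr -big_split.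
apply: eq_bigr => a _.
rewrite /innerF2_term (_ : F2_val (c *: f + g) a = c * F2_val f a + F2_val g a)//.
by rewrite /GRing.scale /=; ring.
Qed.

Fact innerF2C f g : innerF2 g f = (innerF2 f g)^*.
Proof.
apply: (@cvg_lim R[i]^o) => //.
rewrite (_ : wsum _ = fun N => (wsum (innerF2_term f g) N)^* :> R[i]^o).
  by apply: cvg_conjc; exact: innerF2_cvg.
apply/funext => N; rewrite !wsumE rmorph_sum.
apply: eq_bigr => a _.
rewrite /innerF2_term [RHS](_ : _ = ((wprod mu a ^+ 2)%:C)^* *
  (F2_val f a)^* * ((F2_val g a)^*)^*); last by rewrite -!rmorphM.
by rewrite conjCK (conjc_real (wprod mu a ^+ 2) : (_%:C)^* = _) mulrAC.
Qed.

Fact innerF2E f : innerF2 f f = `|f| ^+ 2.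
Proof.
apply: (@cvg_lim R[i]^o) => //.
rewrite normF2E -rmorphXn /= -[_ ^+ 2]/(fine (_ ^+ 2)%:E) sqr_nrmF2.
have foo : (sqnorm mu f < +oo)%E by apply/sqsumP; exact: F2_valP.
have H := wsum_cvg_esum (fun a => term_ge0 mu f a) foo.
rewrite (_ : wsum (innerF2_term f f) = fun N => wsum (fun a =>
  wprod mu a ^+ 2 * normc (F2_val f a) ^+ 2) N +i* 0 :> R[i]^o).
  exact: cvg_complex H (@cvg_cst R^o 0 nat \oo _).
apply/funext => N; rewrite wsum_complex; congr (_ +i* _).
  rewrite !wsumE; apply: eq_bigr => a _ /=.
  rewrite /innerF2_term -mulrA -sqr_normc -[`|_|]/((normc _)%:C).
  by rewrite -rmorphXn -rmorphM.
rewrite wsumE big1// => a _ /=.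
rewrite /innerF2_term -mulrA -sqr_normc -[`|_|]/((normc _)%:C).
by rewrite -rmorphXn -rmorphM.
Qed.

Lemma F2_complete (F : set_system (F2 mu)) :
  ProperFilter F -> cauchy F -> cvg F.
Proof.
move=> FF /cauchy_ballP Fc.
have Fe (e : R) : 0 < e -> exists A : set (F2 mu),
    F A /\ forall f g, A f -> A g -> nrmF2 (f - g) <= e.
  move=> e0.
  have e0' : 0 < e%:C :> R[i] by rewrite ltcR.
  have [[A B] /= [FA FB] AB] := Fc _ e0'.
  exists (A `&` B); split; first exact: filterI.
  move=> f g [Af _] [_ Bg].
  have := AB (f, g) (conj Af Bg).
  by rewrite -ball_normE /= normF2E ltcR => /ltW.
have coord (p : R[i] -> R) : (forall x y, p x - p y = p (x - y)) ->
    (forall x, `|p x| <= normc x) ->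
    forall a, cvg ((fun f : F2 mu => p (F2_val f a) : R) @ F).
  move=> pB pn a; apply: cauchy_cvg; apply/cauchy_ballP => e e0.
  have [|A [FA HA]] := Fe (e * wprod mu a / 2).
    by rewrite divr_gt0// mulr_gt0// wprod_gt0.
  have FgA : F ((fun f : F2 mu => p (F2_val f a)) @^-1`
      ((fun f : F2 mu => p (F2_val f a)) @` A)).
    by apply: filterS FA => f Af; exists f.
  exists (((fun f : F2 mu => p (F2_val f a)) @` A),
          ((fun f : F2 mu => p (F2_val f a)) @` A)) => /=.
    by split; exact: FgA.
  move=> [x y] /= [[f Af <-] [g Ag <-]].
  rewrite -ball_normE /= pB.
  apply: (le_lt_trans (pn _)).
  have w0 := wprod_gt0 mu a.
  rewrite -(ltr_pM2l w0).
  have -> : F2_val f a - F2_val g a = F2_val (f - g) a by [].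
  apply: (le_lt_trans (coef_le_nrmF2 _ _)).
  apply: (le_lt_trans (HA _ _ Af Ag)).
  by rewrite -(mulrC e) ltr_pdivrMr// ltr_pMr ?mulr_gt0// ltr1n.
have cRe := coord _ (fun x y => esym (raddfB (@complex.Re R : Rcomplex R -> R) x y))
  (@normc_ge_Re' R).
have cIm := coord _ (fun x y => esym (raddfB (@complex.Im R : Rcomplex R -> R) x y))
  (@normc_ge_Im R).
pose l : fps R n := fun a => lim ((fun f : F2 mu => complex.Re (F2_val f a)) @ F)
  +i* lim ((fun f : F2 mu => complex.Im (F2_val f a)) @ F).
have close (e : R) (A : set (F2 mu)) : 0 < e -> F A ->
    (forall f g, A f -> A g -> nrmF2 (f - g) <= e) ->
    forall f, A f -> (sqnorm mu ((f : fps R n) - l)%R <= (e ^+ 2)%:E)%E.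
  move=> e0 FA HA f Af; apply: ge_ereal_sup => _ [X [finX _] <-].
  have /finite_seqP[s0 Xs] := finX.
  pose s := undup s0.
  have -> : X = [set` s].
    by rewrite Xs; apply/seteqP; split=> x /=; rewrite mem_undup.
  rewrite -fsbig_seq ?undup_uniq// sumEFin lee_fin.
  pose u a (g : F2 mu) := wprod mu a ^+ 2 *
    ((complex.Re (F2_val f a) - complex.Re (F2_val g a)) ^+ 2 +
     (complex.Im (F2_val f a) - complex.Im (F2_val g a)) ^+ 2).
  have uE a g : u a g = wprod mu a ^+ 2 * normc (F2_val (f - g) a) ^+ 2.
    rewrite /u sqr_normc2.
    have -> : F2_val (f - g) a = F2_val f a - F2_val g a by [].
    by case: (F2_val f a) => ? ?; case: (F2_val g a).
  have ucvg : (fun g => \sum_(a <- s) u a g) @ F -->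
      \sum_(a <- s) wprod mu a ^+ 2 * normc (F2_val f a - l a) ^+ 2.
    elim: (s) => [|a s1 ih].
      by rewrite big_nil; under eq_fun do rewrite big_nil; exact: cvg_cst.
    rewrite big_cons; under eq_fun do rewrite big_cons.
    apply: cvgD ih.
    rewrite sqr_normc2; apply: cvgMr; rewrite /=.
    have -> : complex.Re (F2_val f a - l a) = complex.Re (F2_val f a) - complex.Re (l a).
      by case: (F2_val f a) => ? ?.
    have -> : complex.Im (F2_val f a - l a) = complex.Im (F2_val f a) - complex.Im (l a).
      by case: (F2_val f a) => ? ?.
    apply: cvgD; rewrite expr2; under eq_fun do rewrite expr2.
      by apply: cvgM; (apply: cvgB; [exact: cvg_cst|exact: cRe]).
    by apply: cvgM; (apply: cvgB; [exact: cvg_cst|exact: cIm]).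
  apply: (cvgr_to_le ucvg).
  apply: filterS FA => g Ag.
  rewrite (eq_bigr _ (fun a _ => uE a g)).
  rewrite -lee_fin -sumEFin (@fsbig_seq _ _ _ _ s) ?undup_uniq//.
  apply: (@le_trans _ _ (sqnorm mu (f - g))).
    by apply: esum_ge; exists [set` s] => //; split=> //; exact: finite_seq.
  by rewrite le_nrmF2 ?HA// ltW.
have lF2 : l \in sqsum mu.
  have [A [FA HA]] := Fe 1 ltr01.
  have [f Af] := filter_ex FA.
  rewrite -[l](subKr (f : fps R n)) rpredB ?F2_valP//.
  by apply/sqsumP/(le_lt_trans (close _ _ ltr01 FA HA _ Af)); rewrite ltry.
apply/cvg_ex; exists (F2_of lF2 : F2 mu); apply/cvgrPdist_le => -[e e'].
rewrite ltcE /= => /andP[/eqP -> e0].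
have [A [FA HA]] := Fe e e0.
apply: filterS (FA) => f Af.
rewrite distrC normF2E lecR -le_nrmF2 ?(ltW e0)//.
exact: (close e A e0 FA HA f Af).
Qed.

HB.instance Definition _ := Uniform_isComplete.Build (F2 mu) F2_complete.

HB.instance Definition _ :=
  NormedModule_hasInner.Build R (F2 mu) innerF2P innerF2C innerF2E.

End F2_hilbert.


Section operators.
Context (R : realType).

Definition opnorm (V W : normedModType R[i]) (T : V -> W) : \bar R :=
  ereal_sup [set (complex.Re `|T x|)%:E | x in [set x : V | `|x| <= 1]].

Definition bounded_op (V W : normedModType R[i]) (T : {linear V -> W}) : Prop :=
  (opnorm T < +oo)%E.

(* By Riesz, the adjoint of a bounded linear T exists and is unique; the value
   0 is only a default for the other maps T. *)
Definition adjoint (H : hilbertType R) (T : H -> H) : H -> H :=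
  xget (fun=> 0) [set S : H -> H | forall x y, inner (T x) y = inner x (S y)].

Section tuples.
Context (n : nat).

Definition word_op (V : lmodType R[i]) (X : 'I_n -> {linear V -> V})
    (a : word n) (x : V) : V :=
  foldr (fun i y => X i y) x a.

Definition tuple_norm (H : hilbertType R) (X : 'I_n -> {linear H -> H})
    : \bar R :=
  (opnorm (fun x => \sum_i X i (adjoint (X i) x))%R `^ 2^-1)%E.

Definition op_ball (H : hilbertType R) (r : \bar R)
    : set ('I_n -> {linear H -> H}) :=
  [set X | (forall i, bounded_op (X i)) /\ (tuple_norm X < r)%E].

Definition joint_point_spectrum (V : lmodType R[i]) (X : 'I_n -> V -> V)
    : set 'rV[R[i]]_n :=
  [set z | exists2 x : V, x != 0 & forall i, X i x = z 0 i *: x].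

(* S = phi(X): by linearity, opnorm is a norm on B(H), and this is convergence
   of the partial sums over |a| < N in that norm. *)
Definition is_free_value (phi : fps R n) (H : hilbertType R)
    (X : 'I_n -> {linear H -> H}) (S : {linear H -> H}) : Prop :=
  bounded_op S /\
  (fun N => opnorm (fun x => wsum (fun a => phi a *: word_op X a x) N - S x))
    @ \oo --> 0%E.

Definition free_holomorphic (phi : fps R n) (r : \bar R) : Prop :=
  forall (H : hilbertType R) (X : 'I_n -> {linear H -> H}),
    op_ball r X -> exists S, is_free_value phi X S.

Definition free_sup (H : hilbertType R) (phi : fps R n) (r : \bar R) : \bar R :=
  ereal_sup [set y | exists X : 'I_n -> {linear H -> H}, exists S,
    [/\ op_ball r X, is_free_value phi X S & y = opnorm S]].

End tuples.

Definition separable_space (T : topologicalType) : Prop :=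
  exists2 A : set T, countable A & dense A.

Definition infinite_dimensional (V : lmodType R[i]) : Prop :=
  ~ exists (m : nat) (v : 'I_m -> V), forall x, exists a : 'I_m -> R[i],
      x = \sum_i a i *: v i.

End operators.

Section multipliers.
Context (R : realType) (n : nat) (mu : weight R n).

Definition left_multiplier (phi : fps R n) : Prop :=
  forall f : F2 mu, fsmul phi f \in sqsum mu.

Definition Lmul (phi : fps R n) (h : left_multiplier phi) (f : F2 mu) : F2 mu :=
  F2_of (h f).

Fact Lmul_is_linear phi (h : left_multiplier phi) : linear (Lmul h).
Proof.
move=> c f g; apply: val_inj; apply/funext => a.
rewrite /= [RHS](_ : _ =
  c * fsmul phi f a + fsmul phi g a :> R[i])//.
rewrite /fsmul mulr_sumr -big_split /=; apply: eq_bigr => k _.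
apply: (@etrans _ _ ((phi (take k a) : R[i]) *
  (c * F2_val f (drop k a) + F2_val g (drop k a)))) => //.
rewrite mulrDr; congr (_ + _); exact: mulrCA.
Qed.
HB.instance Definition _ phi (h : left_multiplier phi) :=
  GRing.isLinear.Build R[i] (F2 mu) (F2 mu) _ (Lmul h) (Lmul_is_linear h).

Lemma fsmul_Zvar (i : 'I_n) (f : fps R n) (a : word n) :
  fsmul (Zvar R i) f a = if a is j :: b then (j == i)%:R * f b else 0.
Proof.
rewrite /fsmul /Zvar; case: a => [|j b].
  by rewrite big_ord_recl big_ord0 /= mul0r addr0.
rewrite big_ord_recl /= mul0r add0r big_ord_recl /= take0 drop0 big1 ?addr0.
  by rewrite eqseq_cons andbT.
move=> k _; rewrite /bump /= !add1n.
case: b k => [[]//|j' b k] /=.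
by rewrite eqseq_cons andbF mul0r.
Qed.

Fact Zvar_left_multiplier (i : 'I_n) : left_multiplier (Zvar R i).
Proof.
move=> f; apply/sqsumP.
have [M HM] := weight_bounded mu.
have foo : (sqnorm mu f < +oo)%E by apply/sqsumP; exact: F2_valP.
apply: (@le_lt_trans _ _ ((M ^+ 2)%:E * sqnorm mu f)%E); last first.
  by apply: lte_mul_pinfty; rewrite // lee_fin sqr_ge0.
apply: (le_trans _ (esum_le_scale (sqr_ge0 M) (term_ge0 mu f))).
rewrite /sqnorm.
have -> : \esum_(a in [set: word n])
    (wprod mu a ^+ 2 * normc (fsmul (Zvar R i) f a) ^+ 2)%:E =
  \esum_(a in cons i @` [set: word n])
    (wprod mu a ^+ 2 * normc (fsmul (Zvar R i) f a) ^+ 2)%:E.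
  rewrite [RHS]esum_mkcond; apply: eq_esum => a _.
  case: ifPn => //; rewrite notin_setE => ai.
  rewrite fsmul_Zvar; case: a ai => [|j b] ai.
    by rewrite normc0 expr0n mulr0.
  have [ji|ji] := eqVneq j i; first by case: ai; exists b; rewrite ?ji.
  by rewrite mul0r normc0 expr0n mulr0.
rewrite esum_image; last by move=> a b _ _ [].
apply: le_esum => a _; rewrite lee_fin fsmul_Zvar eqxx mul1r /= exprMn -mulrA.
rewrite ler_wpM2r ?term_ge0// ler_sqr ?nnegrE ?HM ?(ltW (weight_gt0 _ _))//.
by apply: le_trans (HM i a); exact/ltW/weight_gt0.
Qed.

Definition LZ (i : 'I_n) : {linear F2 mu -> F2 mu} :=
  Lmul (Zvar_left_multiplier i).

Definition vanishes_from (N : nat) (p : fps R n) : Prop :=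
  forall a, (N <= size a)%N -> p a = 0.

Lemma poly_sqsum (p : fps R n) N : vanishes_from N p -> p \in sqsum mu.
Proof.
move=> pN; apply/sqsumP.
apply: (@le_lt_trans _ _ (wsum (fun a => wprod mu a ^+ 2 * normc (p a) ^+ 2) N)%:E);
  last by rewrite ltry.
apply: ge_ereal_sup => _ [X [finX _] <-].
have [M /le_trans-> //] := fsum_le_wsum finX (term_ge0 mu p).
rewrite lee_fin; have [MN|/ltnW NM] := leqP M N.
  exact: nondecreasing_wsum (term_ge0 mu p) _ _ MN.
rewrite le_eqVlt -(subnKC NM); apply/orP; left; apply/eqP.
elim: (M - N)%N => [|k ih]; first by rewrite addn0.
rewrite addnS -[RHS]ih /wsum big_ord_recr /= [X in _ + X]big1 ?addr0// => a _.
by rewrite pN ?size_tuple ?leq_addr// normc0 expr0n mulr0.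
Qed.

(* T = phi(L_Z1, ..., L_Zn), which is unique as polynomials are dense in F2 *)
Definition is_LZ_value (phi : fps R n) (T : {linear F2 mu -> F2 mu}) : Prop :=
  bounded_op T /\
  forall (N : nat) (p : F2 mu), vanishes_from N p ->
    wsum (fun a => phi a *: word_op LZ a p) @ \oo --> T p.

End multipliers.

Section evaluation.
Context (R : realType) (n : nat) (mu : weight R n).
Implicit Types lam : 'rV[R[i]]_n.

Definition word_val lam (a : word n) : R[i] := \prod_(i <- a) lam 0 i.

Definition eval_sum (f : fps R n) lam : nat -> R[i]^o :=
  wsum (fun a => (f a : R[i]) * word_val lam a).

Definition fps_eval lam (f : fps R n) : R[i]^o := limn (eval_sum f lam).

Definition extends_eval lam (Phi : {linear F2 mu -> R[i]^o}) : Prop :=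
  bounded_op Phi /\
  forall (N : nat) (p : F2 mu), vanishes_from N p -> Phi p = eval_sum p lam N.

Definition eval_domain : set 'rV[R[i]]_n :=
  [set lam | exists Phi, extends_eval lam Phi].

Definition kernel_sum lam : \bar R :=
  \esum_(a in [set: word n]) (normc (word_val lam a) ^+ 2 / wprod mu a ^+ 2)%:E.

End evaluation.

(* Main.v *)
(** The functional of evaluation at [lam] is [f |-> <f, k>] for the kernel
    [k(a) = conj(lam_a) / wprod(a)^2]; testing a bounded extension on the
    truncations of [k] shows that [k] has finite norm. Since the adjoint of [L_Zi]
    sends [f] to [a |-> mu(i a)^2 f(i a)], a joint eigenvector for [lam] is
    determined by its constant term and equals, up to that scalar,
    [a |-> lam_a / wprod(a)^2], which has the norm of [k]. If the kernel had
    infinite norm, Abel-Dini would give [f] in [F^2] whose series at [lam]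
    diverges.

    For the multiplier bound, compress [r L_Z] (with [r < 1]) to the words of
    length at most [N] and carry it into [H] along a finite orthonormal family.
    This tuple lies in the open ball, because its row norm is at most [r sup mu]
    and [sup mu <= ||L_Z||], and it is nilpotent, so that [phi] of it is the
    compression of multiplication by [phi(r Z)]. Letting [r -> 1], then
    [N -> oo], the supremum bounds multiplication by [phi]. *)
From HB Require Import structures.
Require Import Defs.
From mathcomp Require Import all_boot all_order all_algebra.
From mathcomp Require Import all_classical all_reals all_analysis.
From mathcomp Require Import complex.
From mathcomp Require Import ring lra.
Set Implicit Arguments.
Unset Strict Implicit.
Unset Printing Implicit Defensive.
Import Order.TTheory GRing.Theory Num.Theory.
Import numFieldNormedType.Exports.
Import ComplexField.Normc.
Local Open Scope classical_set_scope.
Local Open Scope complex_scope.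
Local Open Scope ring_scope.

(** * Hilbert space geometry *)

Section real_norm.
Context (R : realType).
Implicit Types (V : normedModType R[i]) (c : R[i]).

Definition rnorm (V : normedModType R[i]) (x : V) : R := complex.Re `|x|.

Lemma normE V (x : V) : `|x| = (rnorm x)%:C.
Proof.
have := normr_ge0 x; rewrite /rnorm; case: (`|x|) => a b.
by rewrite lecE /= => /andP[/eqP -> _].
Qed.

Lemma rnorm_ge0 V (x : V) : 0 <= rnorm x.
Proof. by rewrite -lecR -normE normr_ge0. Qed.

Lemma rnorm0 V : rnorm (0 : V) = 0.
Proof. by rewrite /rnorm normr0. Qed.

Lemma rnorm0_eq0 V (x : V) : rnorm x = 0 -> x = 0.
Proof. by move=> x0; apply: normr0_eq0; rewrite normE x0. Qed.

Lemma rnorm_gt0 V (x : V) : x != 0 -> 0 < rnorm x.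
Proof.
by move=> x0; rewrite lt_def rnorm_ge0 andbT; apply: contra_neq x0 => /rnorm0_eq0.
Qed.

Lemma normc_norm (z : R[i]) : `|z| = (normc z)%:C.
Proof. by []. Qed.

Lemma conj_real (r : R) : (r%:C)^* = r%:C.
Proof. exact: conjc_real. Qed.

Lemma rnormZ V c (x : V) :
  rnorm (c *: x) = normc c * rnorm x.
Proof. by apply: complexI; rewrite -normE normrZ normE normc_norm -rmorphM. Qed.

End real_norm.

Section inner_algebra.
Context (R : realType) (H : hilbertType R).
Implicit Types (x y z : H) (c : R[i]).

Lemma inner0l y : inner 0 y = 0.
Proof.
have := innerP 1 0 0 y; rewrite scaler0 addr0 mul1r => /eqP.
by rewrite -subr_eq0 opprD addNKr oppr_eq0 => /eqP.
Qed.

Lemma innerDl x y z : inner (x + y) z = inner x z + inner y z.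
Proof. by have := innerP 1 x y z; rewrite scale1r mul1r. Qed.

Lemma innerZl c x z : inner (c *: x) z = c * inner x z.
Proof. by have := innerP c x 0 z; rewrite addr0 inner0l addr0. Qed.

Lemma innerNl x z : inner (- x) z = - inner x z.
Proof. by rewrite -scaleN1r innerZl mulN1r. Qed.

Lemma inner_suml (T : Type) (s : seq T) (F : T -> H) z :
  inner (\sum_(a <- s) F a) z = \sum_(a <- s) inner (F a) z.
Proof.
elim: s => [|a s ih]; first by rewrite !big_nil inner0l.
by rewrite !big_cons innerDl ih.
Qed.

Lemma innerDr x y z : inner x (y + z) = inner x y + inner x z.
Proof. by rewrite innerC innerDl rmorphD /= -!innerC. Qed.

Lemma innerZr c x z : inner x (c *: z) = c^* * inner x z.
Proof. by rewrite innerC innerZl rmorphM /= -innerC. Qed.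

Lemma innerNr x z : inner x (- z) = - inner x z.
Proof. by rewrite innerC innerNl rmorphN /= -innerC. Qed.

Lemma inner_sumr (T : Type) (s : seq T) (F : T -> H) z :
  inner z (\sum_(a <- s) F a) = \sum_(a <- s) inner z (F a).
Proof.
by rewrite innerC inner_suml rmorph_sum; apply: eq_bigr => a _ /=; rewrite -innerC.
Qed.

Lemma inner_rnorm x : inner x x = (rnorm x ^+ 2)%:C.
Proof. by rewrite innerE normE rmorphXn. Qed.

(** [adjoint] is a choice, so it is computed by exhibiting a candidate. Two maps with the same
    pairing differ at each point by a vector orthogonal to itself, hence zero. *)
Lemma adjoint_unique (T S : H -> H) :
  (forall x y, inner (T x) y = inner x (S y)) -> adjoint T = S.
Proof.
move=> TS; have := @xgetPex _ (fun=> 0)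
  [set S : H -> H | forall x y, inner (T x) y = inner x (S y)] (ex_intro _ S TS).
rewrite -/(adjoint T) => /= TA; apply/funext => y.
apply/eqP; rewrite -subr_eq0; apply/eqP/rnorm0_eq0/eqP.
rewrite -sqrf_eq0 -(inj_eq (@complexI R)) -inner_rnorm.
by rewrite {2}/GRing.add /= innerDr innerNr -TA -TS subrr.
Qed.

Section orthonormal.
Context (T : eqType) (s : seq T) (e : T -> H).

Definition orthonormal_on := {in s &, forall a b, inner (e a) (e b) = (a == b)%:R}.

Context (us : uniq s) (eo : orthonormal_on).

Lemma inner_lincomb (c : T -> R[i]) b : b \in s ->
  inner (\sum_(a <- s) c a *: e a) (e b) = c b.
Proof.
move=> bs; rewrite inner_suml (bigD1_seq b)//= innerZl eo// eqxx mulr1.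
rewrite big_seq_cond big1 ?addr0// => a /andP[as_ /negPf ab].
by rewrite innerZl eo// ab mulr0.
Qed.

Lemma inner_lincomb2 (c d : T -> R[i]) :
  inner (\sum_(a <- s) c a *: e a) (\sum_(a <- s) d a *: e a) =
  \sum_(a <- s) c a * (d a)^*.
Proof.
rewrite inner_sumr big_seq [RHS]big_seq; apply: eq_bigr => a sa.
by rewrite innerZr inner_lincomb// mulrC.
Qed.

Lemma sqr_rnorm_lincomb (c : T -> R[i]) :
  rnorm (\sum_(a <- s) c a *: e a) ^+ 2 = \sum_(a <- s) normc (c a) ^+ 2.
Proof.
apply: complexI; rewrite -inner_rnorm inner_lincomb2 rmorph_sum.
by apply: eq_bigr => a _; rewrite -sqr_normc normc_norm -rmorphXn.
Qed.

(** The cross terms [<x, p>] and [<p, x>] with the projection [p] both equal [<p, p>], so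
    [|x - p|^2 = |x|^2 - |p|^2]. *)
Lemma bessel x : \sum_(a <- s) normc (inner x (e a)) ^+ 2 <= rnorm x ^+ 2.
Proof.
pose p := \sum_(a <- s) inner x (e a) *: e a.
have := sqr_ge0 (rnorm (x - p)).
rewrite -sqr_rnorm_lincomb -/p -lecR -inner_rnorm innerDl innerNl !innerDr !innerNr.
have xp : inner x p = inner p p.
  rewrite /p inner_lincomb2 inner_sumr; apply: eq_bigr => a _.
  by rewrite innerZr mulrC.
have px : inner p x = inner p p.
  by rewrite innerC xp -innerC.
by rewrite xp px subrr subr0 !inner_rnorm -rmorphB lecR subr_ge0.
Qed.

End orthonormal.

(** Bessel's inequality for the single vector [y / |y|]. *)
Lemma cauchy_schwarz x y : normc (inner x y) <= rnorm x * rnorm y.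
Proof.
have [->|y0] := eqVneq y 0.
  by rewrite -(scale0r 0) innerZr rmorph0 mul0r normc0 mulr_ge0 ?rnorm_ge0.
have ny := rnorm_gt0 y0.
pose e (_ : unit) := ((rnorm y)^-1)%:C *: y.
have eo : orthonormal_on [:: tt] e.
  move=> [] [] _ _; rewrite innerZl innerZr conj_real inner_rnorm eqxx -!rmorphM/=.
  by rewrite (_ : _ * _ = 1)//; field; rewrite gt_eqF.
have := bessel (isT : uniq [:: tt]) eo x.
rewrite big_seq1 ler_sqr ?nnegrE ?normcge0 ?rnorm_ge0// innerZr conj_real normcM.
rewrite normc_real ger0_norm ?invr_ge0 ?(ltW ny)//.
by rewrite ler_pdivrMl// mulrC.
Qed.

(** Gram-Schmidt along the list: infinite dimension gives [x] outside the span of the vectors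
    already chosen, and its component orthogonal to them is normalised. *)
Lemma exists_orthonormal (T : eqType) (s : seq T) : uniq s ->
  infinite_dimensional H -> exists e : T -> H, orthonormal_on s e.
Proof.
move=> + infH; elim: s => [_|t s ih /= /andP[ts us]].
  by exists (fun=> 0) => a b; rewrite in_nil.
have [e eo] := ih us.
have [x Hx] : exists x, forall a : T -> R[i], x <> \sum_(i <- s) a i *: e i.
  apply: contrapT => /forallNP Hn; apply: infH.
  exists (size s), (fun i => e (nth t s i)) => x.
  have /existsNP[a /contrapT ->] := Hn x.
  by exists (fun i => a (nth t s i)); rewrite (big_nth t) big_mkord.
pose y := x - \sum_(i <- s) inner x (e i) *: e i.
have y0 : y != 0 by rewrite subr_eq0; apply/eqP/Hx.
have ny := rnorm_gt0 y0.
have ye i : i \in s -> inner y (e i) = 0.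
  by move=> si; rewrite innerDl innerNl inner_lincomb// subrr.
have ey i : i \in s -> inner (e i) y = 0.
  by move=> si; rewrite innerC ye ?rmorph0.
exists (fun a => if a == t then ((rnorm y)^-1)%:C *: y else e a) => a b.
rewrite !inE; have [->|at_] /= := eqVneq a t.
  move=> _; have [->|bt] /= := eqVneq b t.
    move=> _; rewrite innerZl innerZr conj_real inner_rnorm -!rmorphM/=.
    by rewrite (_ : _ * _ = 1)//; field; rewrite gt_eqF.
  by move=> bs; rewrite innerZl ye// mulr0.
move=> as_; have [->|bt] /= := eqVneq b t.
  by rewrite innerZr ey// mulr0 (negPf at_).
by move=> bs; exact: eo.
Qed.

End inner_algebra.

(** * Operator norms *)

Section opnorm_theory.
Context (R : realType) (V W : normedModType R[i]).
Implicit Types T : V -> W.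

Lemma opnorm_ge0 T : T 0 = 0 -> (0 <= opnorm T)%E.
Proof.
move=> T0; apply: ereal_sup_ubound; exists 0; rewrite /= ?normr0 ?lexx//.
by rewrite T0 normr0.
Qed.

Lemma opnorm_le T (M : R) : 0 <= M -> (forall x, rnorm (T x) <= M * rnorm x) ->
  (opnorm T <= M%:E)%E.
Proof.
move=> M0 TM; apply: ge_ereal_sup => _ [x /= x1 <-]; rewrite lee_fin.
apply: (le_trans (TM x)); rewrite -[leRHS]mulr1 ler_wpM2l//.
by rewrite -lecR -normE.
Qed.

(** Rescaling [x] to the unit sphere only takes homogeneity. The lemma thus serves for maps not
    packaged as linear, such as the row operator of a tuple or the error of a partial sum. *)
Lemma rnorm_le_opnorm T x : (forall c x, T (c *: x) = c *: T x) ->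
  ((rnorm (T x))%:E <= opnorm T * (rnorm x)%:E)%E.
Proof.
move=> TZ.
have T0 : T 0 = 0 by rewrite -(scale0r 0) TZ scale0r.
have [->|x0] := eqVneq x 0; first by rewrite T0 !rnorm0 mule0.
have nx := rnorm_gt0 x0.
rewrite -lee_pdivrMr// -EFinM; apply: ereal_sup_ubound.
exists (((rnorm x)^-1)%:C *: x) => /=.
  by rewrite normE rnormZ normc_real ger0_norm ?invr_ge0 ?(ltW nx)// mulVf ?gt_eqF.
rewrite TZ -/(rnorm _) rnormZ normc_real ger0_norm ?invr_ge0 ?(ltW nx)//.
by rewrite mulrC.
Qed.

Lemma bounded_opP (T : {linear V -> W}) : bounded_op T ->
  exists2 M : R, 0 <= M & forall x, rnorm (T x) <= M * rnorm x.
Proof.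
move=> bT; have T0 := opnorm_ge0 (linear0 T).
have Tfin : opnorm T \is a fin_num by rewrite ge0_fin_numE.
exists (fine (opnorm T)); first exact: fine_ge0.
move=> x; rewrite -lee_fin EFinM fineK//; apply: rnorm_le_opnorm => c y.
exact: linearZ.
Qed.

End opnorm_theory.

(** * Convergence in norm *)

Section rnorm_limits.
Context (R : realType).

(** Norms and radii live in [R[i]], but a positive element of [R[i]] is real, which reduces
    convergence to the real-valued [rnorm]. *)
Lemma cvg_rnormP (V : normedModType R[i]) (u : nat -> V) (l : V) :
  (u @ \oo --> l) <-> ((fun N => rnorm (l - u N)) @ \oo --> (0 : R)).
Proof.
split=> [/cvgrPdist_lt ul|/cvgrPdist_lt ul]; apply/cvgrPdist_lt.
  move=> e e0; have e0' : 0 < e%:C :> R[i] by rewrite ltcR.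
  apply: filterS (ul _ e0') => N.
  by rewrite normE ltcR sub0r normrN ger0_norm ?rnorm_ge0.
move=> [e e']; rewrite ltcE /= => /andP[/eqP -> e0].
apply: filterS (ul _ e0) => N.
by rewrite normE ltcR sub0r normrN ger0_norm ?rnorm_ge0.
Qed.

Lemma cvg_sqr_rnorm_le (V : normedModType R[i]) (u : nat -> V) (l : V) (v : nat -> R) :
  (forall N, rnorm (l - u N) ^+ 2 <= v N) -> v @ \oo --> (0 : R) ->
  u @ \oo --> l.
Proof.
move=> uv /cvgrPdist_lt v0; apply/cvg_rnormP/cvgrPdist_lt => e e0.
have e20 : 0 < e ^+ 2 by rewrite exprn_gt0.
apply: filterS (v0 _ e20) => N.
rewrite !sub0r !normrN => vN; rewrite ger0_norm ?rnorm_ge0//.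
rewrite -ltr_sqr ?nnegrE ?rnorm_ge0 ?(ltW e0)//.
exact: le_lt_trans (uv N) (le_lt_trans (ler_norm _) vN).
Qed.

Lemma bounded_op_cvg (V W : normedModType R[i]) (T : {linear V -> W})
    (u : nat -> V) (l : V) :
  bounded_op T -> u @ \oo --> l -> (fun N => T (u N)) @ \oo --> T l.
Proof.
move=> /bounded_opP[M M0 TM] /cvg_rnormP ul; apply/cvg_rnormP.
apply: (@squeeze_cvgr _ _ _ _ (fun=> 0) (fun N => M * rnorm (l - u N))).
- by near=> N; rewrite rnorm_ge0 -linearB TM.
- exact: cvg_cst.
- by rewrite -(mulr0 M); apply: cvgMl_tmp.
Unshelve. all: by end_near. Qed.

End rnorm_limits.

(** * Words and truncation *)

Section wsum_words.
Context (n : nat).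

Lemma eq_wsum (V : nmodType) (c d : word n -> V) N :
  (forall a, (size a < N)%N -> c a = d a) -> wsum c N = wsum d N.
Proof.
move=> cd; rewrite !wsumE big_seq [RHS]big_seq.
by apply: eq_bigr => a; rewrite mem_words_lt; exact: cd.
Qed.

Lemma wsum_stable (V : nmodType) (c : word n -> V) N M : (N <= M)%N ->
  (forall a, (N <= size a)%N -> c a = 0) -> wsum c M = wsum c N.
Proof.
move=> /subnKC <- c0; elim: (M - N)%N => [|k ih]; first by rewrite addn0.
rewrite addnS -ih /wsum big_ord_recr /= [X in _ + X]big1 ?addr0// => a _.
by rewrite c0// size_tuple leq_addr.
Qed.

Lemma perm_words_ltS N : perm_eq (words_lt n N.+1)
  ([::] :: [seq i :: a | i <- enum 'I_n, a <- words_lt n N]).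
Proof.
apply: uniq_perm; first exact: uniq_words_lt.
  rewrite cons_uniq; apply/andP; split; first by apply/allpairsP => -[[i a] []].
  apply: allpairs_uniq; rewrite ?enum_uniq ?uniq_words_lt//.
  by move=> [i a] [j b] _ _ [-> ->].
move=> [|i a]; rewrite !(mem_words_lt, inE)//=.
apply/idP/allpairsP => [aN|[[j b] [_ /= + [_ ->]]]]; last first.
  by rewrite mem_words_lt.
by exists (i, a); rewrite mem_enum mem_words_lt.
Qed.

(** Recursion on the first letter, the one on which [wprod] and the left shifts act, whereas [wsum]
    is graded by length. *)
Lemma wsumS (V : nmodType) (c : word n -> V) N :
  wsum c N.+1 = c [::] + \sum_i wsum (fun a => c (i :: a)) N.
Proof.
rewrite wsumE (perm_big _ (perm_words_ltS N)) big_cons big_allpairs_dep big_enum.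
by congr (_ + _); apply: eq_bigr => i _; rewrite wsumE.
Qed.

End wsum_words.

Section esum_words.
Context (R : realType) (n : nat).
Implicit Types u : word n -> R.

Lemma esum_le_wsum u (M : R) : (forall a, 0 <= u a) -> (forall N, wsum u N <= M) ->
  (\esum_(a in [set: word n]) (u a)%:E <= M%:E)%E.
Proof.
move=> u0 uM; apply: ge_ereal_sup => _ [X [finX _] <-].
by have [N /le_trans->//] := fsum_le_wsum finX u0; rewrite lee_fin.
Qed.

End esum_words.

Section truncation.
Context (R : realType) (n : nat) (mu : weight R n).
Implicit Types (f : fps R n) (g : F2 mu).

Definition sqterm f a : R := wprod mu a ^+ 2 * normc (f a) ^+ 2.

Lemma sqr_rnormF2 g : (rnorm g ^+ 2)%:E = sqnorm mu g.
Proof. exact: sqr_nrmF2. Qed.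

Definition trunc N f : fps R n := fun a => if (size a < N)%N then f a else 0.

Lemma trunc_vanishes N f : vanishes_from N (trunc N f).
Proof. by move=> a; rewrite leqNgt /trunc => /negbTE ->. Qed.

Definition truncF2 N f : F2 mu := F2_of (poly_sqsum mu (trunc_vanishes (N := N) f)).

Lemma sqnorm_trunc N f : sqnorm mu (trunc N f) = (wsum (sqterm f) N)%:E.
Proof.
have e : wsum (sqterm (trunc N f)) N = wsum (sqterm f) N.
  by apply: eq_wsum => a aN; rewrite /sqterm /trunc aN.
apply/eqP; rewrite eq_le; apply/andP; split; last first.
  by rewrite -e; apply: wsum_le_esum => a; exact: term_ge0.
apply: esum_le_wsum => [a|M]; first exact: term_ge0.
rewrite -e; have [MN|/ltnW NM] := leqP M N.
  exact: nondecreasing_wsum (term_ge0 mu (trunc N f)) _ _ MN.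
rewrite (wsum_stable NM)// => a Na.
by rewrite trunc_vanishes// normc0 expr0n mulr0.
Qed.

Lemma sqr_rnorm_truncF2 N f : rnorm (truncF2 N f) ^+ 2 = wsum (sqterm f) N.
Proof. by apply: EFin_inj; rewrite sqr_rnormF2 sqnorm_trunc. Qed.

(** Head and tail of [g] have disjoint supports, so the squared norm of the tail is at most [|g|^2]
    minus a partial sum of its series. *)
Lemma truncF2_cvg g : (fun N => truncF2 N g) @ \oo --> g.
Proof.
apply: (@cvg_sqr_rnorm_le _ _ _ _ (fun N => rnorm g ^+ 2 - wsum (sqterm g) N)).
  move=> N; rewrite lerBrDl -lee_fin EFinD !sqr_rnormF2 -sqnorm_trunc.
  rewrite -esumD; try by move=> a _; rewrite lee_fin term_ge0.
  apply: le_esum => a _; rewrite -EFinD lee_fin.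
  have -> : F2_val (g - truncF2 N g) a = F2_val g a - trunc N g a by [].
  rewrite /trunc; case: ifP => _; last by rewrite normc0 expr0n mulr0 add0r subr0.
  by rewrite subrr normc0 expr0n mulr0 addr0.
rewrite -(subrr (rnorm g ^+ 2)); apply: cvgB; first exact: cvg_cst.
have := wsum_cvg_esum (term_ge0 mu g) (sqsumP _ _ (F2_valP g)).
by rewrite -[X in fine X]/(sqnorm mu g) -sqr_rnormF2.
Qed.

End truncation.

(** * Point evaluations *)

Section evaluation_functional.
Context (R : realType) (n : nat) (mu : weight R n) (lam : 'rV[R[i]]_n).

Definition kterm (a : word n) : R :=
  normc (word_val lam a) ^+ 2 / wprod mu a ^+ 2.

Lemma kterm_ge0 a : 0 <= kterm a.
Proof. by rewrite divr_ge0 ?sqr_ge0. Qed.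

(* The reproducing kernel: <f, kernel> = f(lam). *)
Definition kernel : fps R n :=
  fun a => (word_val lam a)^* * ((wprod mu a ^- 2)%:C).

Lemma sqterm_kernel a : sqterm mu kernel a = kterm a.
Proof.
rewrite /sqterm /kernel normcM normcJ_R normc_real.
rewrite ger0_norm ?invr_ge0 ?sqr_ge0// /kterm.
by field; rewrite gt_eqF// wprod_gt0.
Qed.

Lemma sqnorm_kernel : sqnorm mu kernel = kernel_sum mu lam.
Proof. by apply: eq_esum => a _; rewrite -/(sqterm _ _ _) sqterm_kernel. Qed.

(** Makes the partial sums of [<f, kernel>] literally those of the evaluation series. *)
Lemma kernel_evalE f a :
  (wprod mu a ^+ 2)%:C * f * (kernel a)^* = f * word_val lam a :> R[i].
Proof.
rewrite /kernel [X in _ * X = _]rmorphM /= conjCK conj_real.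
have w0 : (wprod mu a ^+ 2)%:C * (wprod mu a ^- 2)%:C = 1 :> R[i].
  by rewrite -rmorphM/= divff// gt_eqF// exprn_gt0// wprod_gt0.
by rewrite mulrC -mulrA (mulrA (wprod mu a ^- 2)%:C) (mulrC (_%:C)) w0 mul1r mulrC.
Qed.

Lemma eval_kernel N : eval_sum kernel lam N = (wsum kterm N)%:C.
Proof.
rewrite /eval_sum !wsumE rmorph_sum; apply: eq_bigr => a _.
rewrite -[LHS]kernel_evalE -sqterm_kernel /sqterm -[LHS]mulrA.
by rewrite -sqr_normc normc_norm -rmorphXn -rmorphM.
Qed.

Section extension.
Context (Phi : {linear F2 mu -> R[i]^o}) (PhiP : extends_eval lam Phi).

Lemma eval_truncF2 (f : fps R n) N : Phi (truncF2 mu N f) = eval_sum f lam N.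
Proof.
rewrite (PhiP.2 N) ?trunc_vanishes //.
  by apply: eq_wsum => a aN; rewrite /= /trunc aN.
exact: trunc_vanishes.
Qed.

(** The partial sums are the values of the continuous [Phi] at the truncations of [f], which tend to
    [f]. *)
Lemma eval_sum_cvg (f : F2 mu) : eval_sum f lam @ \oo --> Phi f.
Proof.
have := bounded_op_cvg PhiP.1 (@truncF2_cvg _ _ _ f).
by under eq_fun do rewrite eval_truncF2.
Qed.

Lemma extends_kernel_sum : (kernel_sum mu lam < +oo)%E.
Proof.
have [M M0 PM] := bounded_opP PhiP.1.
apply: (@le_lt_trans _ _ (M ^+ 2)%:E); last by rewrite ltry.
apply: esum_le_wsum => [|N]; first exact: kterm_ge0.
have := PM (truncF2 mu N kernel); rewrite eval_truncF2 eval_kernel.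
have K0 : 0 <= wsum kterm N by rewrite wsumE sumr_ge0// => a _; exact: kterm_ge0.
rewrite {1}/rnorm normc_norm /= expr0n /= addr0 sqrtr_sqr ger0_norm//.
have : rnorm (truncF2 mu N kernel) ^+ 2 = wsum kterm N.
  by rewrite sqr_rnorm_truncF2; apply: eq_wsum => a _; rewrite sqterm_kernel.
have := rnorm_ge0 (truncF2 mu N kernel).
(* With [r] the norm of the truncated kernel, both its value under [Phi] and [r ^+ 2] are the
   partial sum, so the bound reads [r ^+ 2 <= M * r]. *)
move: (rnorm _) => r r0 <-; have [->|rn0] := eqVneq r 0.
  by rewrite expr0n sqr_ge0.
by rewrite expr2 ler_pM2r ?lt_def ?rn0// => rM; rewrite ler_sqr.
Qed.

End extension.

Section kernel_functional.
Context (kfin : (kernel_sum mu lam < +oo)%E).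

Lemma kernel_sqsum : kernel \in sqsum mu.
Proof. by apply/sqsumP; rewrite sqnorm_kernel. Qed.

Definition kernelF2 : F2 mu := F2_of kernel_sqsum.

Definition eval_functional (f : F2 mu) : R[i]^o := inner f kernelF2.

Fact eval_functional_linear : linear eval_functional.
Proof. by move=> c f g; rewrite /eval_functional innerP. Qed.
HB.instance Definition _ :=
  GRing.isLinear.Build R[i] (F2 mu) R[i]^o _ eval_functional eval_functional_linear.

Lemma eval_functional_cvg (f : F2 mu) :
  eval_sum f lam @ \oo --> eval_functional f.
Proof.
have := @innerF2_cvg _ _ _ f kernelF2.
rewrite (_ : wsum _ = eval_sum f lam)//.
by apply/funext => N; apply: eq_wsum => a _; exact: kernel_evalE.
Qed.

Lemma eval_functional_extends : extends_eval lam eval_functional.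
Proof.
split.
  apply: le_lt_trans (opnorm_le (rnorm_ge0 kernelF2) _) (ltry _) => f.
  by rewrite mulrC; exact: cauchy_schwarz.
move=> N p pN; rewrite -[LHS]/(eval_functional p).
have <- := cvg_lim (@norm_hausdorff _ R[i]^o) (@eval_functional_cvg p).
apply: (@cvg_lim R[i]^o); first exact: norm_hausdorff.
(* At a polynomial the partial sums are constant from [N] on. *)
apply: (cvg_near_cst (eval_sum p lam N)).
near=> M; apply: wsum_stable => [|a Na]; last by rewrite pN// mul0r.
by near: M; exact: nbhs_infty_ge.
Unshelve. all: by end_near. Qed.

Lemma rnorm_kernelF2 :
  (kernel_sum mu lam `^ 2^-1)%E = (rnorm kernelF2)%:E.
Proof.
rewrite -sqnorm_kernel -[sqnorm mu kernel]/(sqnorm mu kernelF2) -sqr_rnormF2.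
by rewrite poweR12_sqrt ?lee_fin ?sqr_ge0//= sqrtr_sqr ger0_norm ?rnorm_ge0.
Qed.

End kernel_functional.

Lemma eval_domainE : eval_domain mu lam <-> (kernel_sum mu lam < +oo)%E.
Proof.
split=> [[Phi]|kfin]; first exact: extends_kernel_sum.
by exists (eval_functional kfin); exact: eval_functional_extends.
Qed.

(** With [w] the weight of the word, each term is the product of [w |c_a|] and [|lam_a| / w], which
    is at most the sum of their squares. *)
Lemma eval_abs_summable (f : F2 mu) : (kernel_sum mu lam < +oo)%E ->
  (\esum_(a in [set: word n]) (normc (F2_val f a * word_val lam a))%:E < +oo)%E.
Proof.
move=> kfin; apply: (@le_lt_trans _ _ (sqnorm mu f + kernel_sum mu lam)%E); last first.
  by rewrite lte_add_pinfty//; apply/sqsumP; exact: F2_valP.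
rewrite -esumD; last 2 first.
- by move=> a _; rewrite lee_fin term_ge0.
- by move=> a _; rewrite lee_fin kterm_ge0.
apply: le_esum => a _; rewrite -EFinD lee_fin normcM.
have w0 := wprod_gt0 mu a.
have := normcge0 (word_val lam a); have := normcge0 (F2_val f a).
set x := normc _; set y := normc _; move: (wprod mu a) w0 => w w0 x0 y0.
have -> : w ^+ 2 * x ^+ 2 + y ^+ 2 / w ^+ 2 = (w * x) ^+ 2 + (y / w) ^+ 2.
  by rewrite !exprMn exprVn.
have -> : x * y = (w * x) * (y / w) by field; rewrite gt_eqF.
have u0 : 0 <= w * x by rewrite mulr_ge0// ltW.
have v0 : 0 <= y / w by rewrite divr_ge0// ltW.
move: (w * x) (y / w) u0 v0 => u v u0 v0; nra.
Qed.

End evaluation_functional.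

(* With s the partial sums of q >= 0, the series of q / s diverges with that of
   q, whereas the series of q / s^2 always converges. *)
Section abel_dini.
Context (R : realType) (q s : nat -> R).
Context (q0 : forall k, 0 <= q k) (s0 : 0 < s 0%N) (qs : s 0%N = q 0%N).
Context (sS : forall k, s k.+1 = s k + q k.+1).

Let nds : nondecreasing_seq s.
Proof. by apply/nondecreasing_seqP => k; rewrite sS lerDl. Qed.

Let sp k : 0 < s k.
Proof. exact: lt_le_trans s0 (nds (leq0n k)). Qed.

(** If [s] were unbounded, choose [N] past which the partial sums are within 1/4 of their limit, and
    [M] with [s M > 2 s N]. The terms from [N + 1] to [M] then add up to at least
    [(s M - s N) / s M > 1/2], although two late partial sums differ by less than 1/2. *)
Lemma abel_dini_diverges :
  cvgn (fun N => \sum_(k < N) q k / s k) -> exists M, forall N, s N <= M.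
Proof.
move=> /cvg_ex[/= l /cvgrPdist_lt tl].
apply: contrapT => /forallNP unb.
have {}unb M : exists N, M < s N.
  by have /existsNP[N /negP] := unb M; rewrite -ltNge; exists N.
have e4 : 0 < 4^-1 :> R by rewrite invr_gt0.
have [N _ HN] := tl _ e4.
have [M sM] := unb (2 * s N).
have NM : (N <= M)%N.
  rewrite leqNgt; apply/negP => /ltnW /nds sMN.
  by have := sp N; lra.
pose t K := \sum_(k < K) q k / s k.
have key d : s (N + d)%N - s N <= (t (N + d).+1 - t N.+1) * s (N + d)%N.
  (* The sign of the block is carried along the induction, since enlarging the factor [s (N + d)] to
     the next one requires it. *)
  suff : 0 <= t (N + d).+1 - t N.+1 /\
    s (N + d)%N - s N <= (t (N + d).+1 - t N.+1) * s (N + d)%N by case.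
  elim: d => [|d [t0 ih]]; first by rewrite addn0 !subrr mul0r.
  have tS : t (N + d.+1).+1 - t N.+1 = t (N + d).+1 - t N.+1
      + q (N + d).+1 / s (N + d).+1.
    by rewrite addnS /t [in LHS]big_ord_recr /= addrAC.
  rewrite tS addnS; split; first by rewrite addr_ge0// divr_ge0// ltW.
  rewrite mulrDl divfK ?gt_eqF// sS addrAC lerD2r (le_trans ih)//.
  by rewrite ler_wpM2l// lerDl.
have := key (M - N)%N; rewrite subnKC//.
have := HN N.+1 (leqnSn N); have := HN M.+1 (leqW NM); rewrite /= -/(t _) -/(t _).
rewrite !ltr_norml => /andP[a1 a2] /andP[b1 b2].
have : t M.+1 - t N.+1 < 2^-1 by lra.
move: (t M.+1 - _) => d d2 sd.
have := sp M; have : d * s M <= 2^-1 * s M by rewrite ler_wpM2r ?ltW.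
by lra.
Qed.

(** Telescoping: [q k / s k ^+ 2] is at most the drop of [1 / s] from [k - 1] to [k], and the term
    at 0 equals [1 / s 0]. *)
Lemma abel_dini_sqr_bounded N : \sum_(k < N.+1) q k / s k ^+ 2 <= 2 / s 0%N.
Proof.
suff : \sum_(k < N.+1) q k / s k ^+ 2 <= 2 / s 0%N - (s N)^-1.
  by move=> /le_trans->//; rewrite gerBl invr_ge0 ltW.
elim: N => [|N ih].
  rewrite big_ord_recl big_ord0 /= -qs addr0 le_eqVlt; apply/orP; left; apply/eqP.
  by field; rewrite gt_eqF.
rewrite big_ord_recr /= (le_trans (lerD ih (lexx _)))//.
have -> : q N.+1 = s N.+1 - s N by rewrite sS addrAC subrr add0r.
have sN := sp N; have sN1 := sp N.+1; have := nds (leqnSn N).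
move: (s N) (s N.+1) sN sN1 => x y x0 y0 xy.
rewrite -subr_ge0.
have -> : 2 / s 0%N - y^-1 - (2 / s 0%N - x^-1 + (y - x) / y ^+ 2) =
  (y - x) ^+ 2 / (x * y ^+ 2) by field; rewrite !gt_eqF.
by rewrite divr_ge0 ?sqr_ge0// mulr_ge0 ?sqr_ge0// ltW.
Qed.

End abel_dini.

Section eval_convergence.
Context (R : realType) (n : nat) (mu : weight R n) (lam : 'rV[R[i]]_n).

Lemma cvg_eval_kernel_sum : (forall f : F2 mu, cvgn (eval_sum f lam)) ->
  (kernel_sum mu lam < +oo)%E.
Proof.
move=> cvf; pose q k := \sum_(a : k.-tuple 'I_n) kterm mu lam a.
(* The index [k.+1] makes [s k] include the words of length [k]; the empty word keeps every [s k]
   positive. *)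
pose s k := wsum (kterm mu lam) k.+1.
have q0 k : 0 <= q k by apply: sumr_ge0 => a _; exact: kterm_ge0.
have sS k : s k.+1 = s k + q k.+1 by rewrite /s /wsum big_ord_recr.
have qs : s 0%N = q 0%N by rewrite /s /wsum big_ord_recl big_ord0 addr0.
have s0 : 0 < s 0%N.
  rewrite /s wsumE big_cat big_nil/= add0r big_map big_enum /= (bigD1 [tuple])//=.
  rewrite ltr_pwDl//; last by apply: sumr_ge0 => a _; exact: kterm_ge0.
  by rewrite /kterm /word_val big_nil normc1 divr_gt0// exprn_gt0// wprod_gt0.
(* Dividing the kernel by [s] at the length of the word turns the squared norm into the series of
   [q / s^2], and the series at [lam] into that of [q / s]. *)
pose f : fps R n := fun a => kernel mu lam a * ((s (size a))^-1)%:C.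
have fE N : wsum (sqterm mu f) N = \sum_(k < N) q k / s k ^+ 2.
  apply: eq_bigr => k _; rewrite mulr_suml; apply: eq_bigr => a _.
  rewrite -sqterm_kernel /sqterm /f normcM normc_real size_tuple exprMn real_normK.
    by rewrite exprVn mulrA.
  exact: num_real.
have fF : f \in sqsum mu.
  apply/sqsumP; apply: (@le_lt_trans _ _ (2 / s 0%N)%:E); last by rewrite ltry.
  apply: esum_le_wsum => [a|N]; first exact: term_ge0.
  rewrite -/(sqterm _ _) (le_trans _ (abel_dini_sqr_bounded q0 s0 qs sS N))//.
  rewrite -fE; apply: nondecreasing_wsum => // a; exact: term_ge0.
have eE N : eval_sum f lam N = (\sum_(k < N) q k / s k)%:C.
  rewrite /eval_sum /wsum rmorph_sum; apply: eq_bigr => k _.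
  rewrite mulr_suml rmorph_sum; apply: eq_bigr => a _ /=.
  rewrite /f size_tuple mulrAC -(kernel_evalE mu) -sqterm_kernel /sqterm.
  rewrite [RHS]rmorphM/=; congr (_ * _).
  by rewrite -[LHS]mulrA -sqr_normc normc_norm -rmorphXn -rmorphM.
have [M HM] : exists M, forall N, s N <= M.
  apply: abel_dini_diverges => //.
  have /cvg_ex[/= l /cvgrPdist_lt fl] := cvf (F2_of fF).
  apply/cvg_ex; exists (complex.Re l); apply/cvgrPdist_lt => e e0.
  have e0' : 0 < e%:C :> R[i] by rewrite ltcR.
  apply: filterS (fl _ e0') => N; rewrite eE normc_norm ltcR; apply: le_lt_trans.
  by apply: le_trans (normc_ge_Re' _); case: (l).
apply: (@le_lt_trans _ _ M%:E); last by rewrite ltry.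
apply: esum_le_wsum => [a|N]; first exact: kterm_ge0.
apply: le_trans (HM N).
by apply: nondecreasing_wsum => // a; exact: kterm_ge0.
Qed.

End eval_convergence.

(** * The adjoint shifts *)

Lemma realc_neq0 (R : realType) (r : R) : 0 < r -> r%:C != 0 :> R[i].
Proof. by move=> r0; rewrite fmorph_eq0 gt_eqF. Qed.

Section left_shifts.
Context (R : realType) (n : nat) (mu : weight R n).
Implicit Types (f : fps R n) (g h : F2 mu) (i : 'I_n).

Lemma wprod_consV i (a : word n) : (wprod mu (i :: a) ^- 2)%:C =
  ((mu (i :: a) ^+ 2)%:C)^-1 * (wprod mu a ^- 2)%:C :> R[i].
Proof.
rewrite -[wprod mu (i :: a)]/(mu (i :: a) * wprod mu a) exprMn invfM.
by rewrite [LHS]rmorphM /= [X in X * _ = _]fmorphV.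
Qed.

(** The adjoint of [LZ mu i]: the factor is the ratio of the squared norms of the monomials [i :: a]
    and [a]. *)
Definition bshift i f : fps R n := fun a => (mu (i :: a) ^+ 2)%:C * f (i :: a).

Fact bshift_sqsum i g : bshift i g \in sqsum mu.
Proof.
have [M HM] := weight_bounded mu.
apply/sqsumP; apply: (@le_lt_trans _ _ ((M ^+ 2)%:E * sqnorm mu g)%E); last first.
  by apply: lte_mul_pinfty; rewrite ?lee_fin ?sqr_ge0//; exact/sqsumP/F2_valP.
rewrite -sqr_rnormF2 -EFinM; apply: esum_le_wsum => [a|N]; first exact: term_ge0.
rewrite -/(sqterm _ _); apply: (@le_trans _ _ (M ^+ 2 * wsum (sqterm mu g) N.+1)).
  rewrite wsumS (bigD1 i)//=.
  have c0 : 0 <= sqterm mu g [::] by exact: term_ge0.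
  have r0 : 0 <= \sum_(j | j != i) wsum (fun a => sqterm mu g (j :: a)) N.
    by apply: sumr_ge0 => j _; rewrite wsumE sumr_ge0// => a _; exact: term_ge0.
  apply: (@le_trans _ _ (M ^+ 2 * wsum (fun a => sqterm mu g (i :: a)) N)); last first.
    by rewrite ler_wpM2l ?sqr_ge0// addrCA lerDl addr_ge0.
  rewrite !wsumE mulr_sumr ler_sum// => a _.
  rewrite /sqterm /bshift /= normcM normc_real ger0_norm ?sqr_ge0//.
  rewrite -subr_ge0 (_ : _ - _ = (M ^+ 2 - mu (i :: a) ^+ 2) *
    (mu (i :: a) ^+ 2 * wprod mu a ^+ 2 * normc (F2_val g (i :: a)) ^+ 2)); last by ring.
  have m0 := ltW (weight_gt0 mu (i :: a)).
  apply: mulr_ge0; last by rewrite !mulr_ge0 ?normcge0 ?m0 ?(ltW (wprod_gt0 mu a)).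
  by rewrite subr_ge0 ler_sqr ?nnegrE ?(le_trans m0).
rewrite ler_wpM2l ?sqr_ge0// -lee_fin sqr_rnormF2.
by apply: wsum_le_esum => a; exact: term_ge0.
Qed.

Definition bshiftF2 i g : F2 mu := F2_of (bshift_sqsum i g).

Lemma adjoint_LZ i : adjoint (LZ mu i) = bshiftF2 i.
Proof.
apply: adjoint_unique => g h.
have H1 := @innerF2_cvg _ _ mu (LZ mu i g) h.
have := @innerF2_cvg _ _ mu g (bshiftF2 i h).
(* Prefixing a letter raises lengths by one, so the two inner products have the same partial sums up
   to a shift of the index. *)
have -> : wsum (innerF2_term g (bshiftF2 i h)) =
    (fun N => wsum (innerF2_term (LZ mu i g) h) (N + 1)%N).
  apply/funext => N; rewrite addn1 wsumS.
  have -> : innerF2_term (LZ mu i g) h [::] = 0.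
    by rewrite /innerF2_term /= fsmul_Zvar mulr0 mul0r.
  rewrite add0r.
  rewrite (bigD1 i)//= big1 ?addr0 => [|j ji].
    apply: eq_wsum => a _; rewrite /innerF2_term /= fsmul_Zvar eqxx mul1r /bshift.
    rewrite [(_ * _)^*]rmorphM /= conj_real exprMn rmorphM /=.
    ring.
  rewrite wsumE big1// => a _.
  by rewrite /innerF2_term /= fsmul_Zvar (negPf ji) mul0r mulr0 mul0r.
rewrite cvg_shiftn => H2.
pose hs := @norm_hausdorff _ R[i]^o.
exact: etrans (esym (cvg_lim hs H1)) (cvg_lim hs H2).
Qed.

Lemma spectrum_kernel_sum (lam : 'rV[R[i]]_n) :
  joint_point_spectrum (fun i => adjoint (LZ mu i)) lam <->
  (kernel_sum mu lam < +oo)%E.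
Proof.
split.
  move=> [/= g g0 eg].
  have gE a : F2_val g a = word_val lam a * (wprod mu a ^- 2)%:C * F2_val g [::].
    elim: a => [|i a ih]; first by rewrite /word_val big_nil /= expr1n invr1 !mul1r.
    have : bshift i g a = lam 0 i * F2_val g a.
      by have := congr1 (fun h => F2_val h a) (eg i); rewrite adjoint_LZ.
    rewrite /bshift ih /word_val big_cons.
    rewrite -[\prod_(_ <- a) _]/(word_val lam a).
    have m0 : (mu (i :: a) ^+ 2)%:C != 0 :> R[i].
      by apply: realc_neq0; rewrite exprn_gt0// weight_gt0.
    by move=> /(canRL (mulKf m0)) ->; rewrite wprod_consV; ring.
  (* A vanishing constant term would make the whole eigenvector vanish, by [gE]. *)
  have g10 : normc (F2_val g [::]) != 0.
    apply: contra_neq g0 => /eq0_normc g1; apply: val_inj; apply/funext => a.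
    by rewrite /= gE g1 mulr0.
  rewrite (_ : kernel_sum mu lam =
    \esum_(a in [set: word n]) (normc (F2_val g [::]) ^- 2 * (sqterm mu g a))%:E).
    apply: le_lt_trans (esum_le_scale _ _) _; first by rewrite invr_ge0 sqr_ge0.
      by move=> a; exact: term_ge0.
    by apply: lte_mul_pinfty; rewrite ?lee_fin ?invr_ge0 ?sqr_ge0//; exact/sqsumP/F2_valP.
  apply: eq_esum => a _; congr (_%:E); rewrite /sqterm (gE a) !normcM normc_real.
  rewrite ger0_norm ?invr_ge0 ?sqr_ge0//; field.
  by rewrite g10 gt_eqF// wprod_gt0.
(* The coefficients of [kernel] without the conjugation: the eigenvalues must be those of [lam]
   itself, and the norm is unchanged. *)
move=> kfin; pose k : fps R n := fun a => word_val lam a * (wprod mu a ^- 2)%:C.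
have kF : k \in sqsum mu.
  apply/sqsumP; rewrite (_ : sqnorm mu k = kernel_sum mu lam)//.
  apply: eq_esum => a _; congr (_%:E).
  rewrite -/(kterm _ _ _) -sqterm_kernel /sqterm /kernel /k.
  by rewrite !normcM normcJ_R.
exists (F2_of kF).
  apply/eqP => k0.
  have /eqP : k [::] = 0 by exact: (congr1 (fun h => F2_val h [::]) k0).
  by rewrite /k /word_val big_nil /= expr1n invr1 mulr1 oner_eq0.
move=> i; rewrite adjoint_LZ; apply: val_inj; apply/funext => a.
rewrite /= /bshift [RHS](_ : _ = lam 0 i * k a)// /k /word_val big_cons.
rewrite wprod_consV; field.
by rewrite !realc_neq0 ?weight_gt0 ?wprod_gt0.
Qed.

Definition monomial (b : word n) : fps R n := fun a => (a == b)%:R.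

Fact monomial_vanishes b : vanishes_from (size b).+1 (monomial b).
Proof.
by move=> a ba; rewrite /monomial; case: eqP ba => // ->; rewrite ltnn.
Qed.

Definition monomialF2 b : F2 mu := F2_of (poly_sqsum mu (@monomial_vanishes b)).

(** The monomial of [i :: a] is an eigenvector of the row operator, with eigenvalue
    [mu (i :: a) ^+ 2]. *)
Lemma sqr_weight_le_opnorm i a :
  ((mu (i :: a) ^+ 2)%:E <=
   opnorm (fun x => \sum_j LZ mu j (adjoint (LZ mu j) x))%R)%E.
Proof.
pose b := i :: a; set T := (fun x => _).
have TZ (c : R[i]) x : T (c *: x) = c *: T x.
  rewrite /T scaler_sumr; apply: eq_bigr => j _; rewrite -linearZ; congr (LZ mu j _).
  rewrite adjoint_LZ; apply: val_inj; apply/funext => w; exact: mulrCA.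
have := @rnorm_le_opnorm _ _ _ T (monomialF2 b) TZ.
have -> : T (monomialF2 b) = (mu b ^+ 2)%:C *: monomialF2 b.
  apply: val_inj; apply/funext => w.
  have -> : val (T (monomialF2 b)) w = \sum_j F2_val (LZ mu j (bshiftF2 j (monomialF2 b))) w.
    rewrite /T; elim/big_rec2: _ => // j y1 y2 _ <-; rewrite adjoint_LZ//.
  rewrite [RHS](_ : _ = (mu b ^+ 2)%:C * monomial b w)//.
  case: w => [|j w].
    by rewrite big1 /= ?mulr0// => j _; rewrite fsmul_Zvar.
  rewrite (bigD1 j)//= big1 ?addr0 => [|k kj].
    rewrite fsmul_Zvar eqxx mul1r /bshift /= /monomial.
    by have [->|] := eqVneq (j :: w) b; rewrite ?mulr0.
  by rewrite fsmul_Zvar eq_sym (negPf kj) mul0r.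
rewrite rnormZ normc_real ger0_norm ?sqr_ge0// EFinM.
have m0 : 0 < rnorm (monomialF2 b).
  apply: rnorm_gt0; apply/eqP => b0.
  have /eqP : monomial b b = 0 by exact: (congr1 (fun h => F2_val h b) b0).
  by rewrite /monomial eqxx oner_eq0.
by rewrite lee_pmul2r// lte_fin.
Qed.

End left_shifts.

(** * Free functional calculus *)

Section word_shifts.
Context (R : realType) (n : nat).
Implicit Types (phi g : fps R n) (c b : word n).

(** Multiplication by the monomial of [c], on all formal series so as to serve both [F2] and the
    finite models. *)
Definition wshift c g : fps R n := foldr (fun i f => fsmul (Zvar R i) f) g c.

Lemma wshiftE c g b :
  wshift c g b = if take (size c) b == c then g (drop (size c) b) else 0.
Proof.
elim: c b => [|i c ih] b /=; first by rewrite take0 drop0.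
rewrite fsmul_Zvar; case: b => // j b; rewrite ih eqseq_cons.
by case: (j == i); rewrite ?mul1r ?mul0r.
Qed.

(** Only prefixes of [b] contribute at [b], and there is exactly one of each length up to that of
    [b]. *)
Lemma wsum_wshift phi g M b :
  wsum (fun c => (phi c : R[i]) * wshift c g b) M =
  \sum_(k < (size b).+1 | (k < M)%N) (phi (take k b) : R[i]) * g (drop k b).
Proof.
pose F k := (phi (take k b) : R[i]) * g (drop k b).
transitivity (\sum_(0 <= k < M | (k < (size b).+1)%N) F k).
  rewrite big_mkord /wsum [RHS]big_mkcond; apply: eq_bigr => k _.
  case: ifPn => [kb|kb].
    have sk : size (take k b) == k by rewrite size_takel.
    rewrite (bigD1 (Tuple sk))//= wshiftE /= size_takel// eqxx big1 ?addr0//.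
    move=> a ak; rewrite wshiftE size_tuple; case: eqP => [tk|]; last by rewrite mulr0.
    by case/eqP: ak; apply: val_inj; rewrite /= tk.
  apply: big1 => a _; rewrite wshiftE size_tuple; case: eqP => [tk|]; last by rewrite mulr0.
  rewrite -leqNgt in kb; have := size_tuple a.
  by rewrite -tk size_take_min (minn_idPr (ltnW kb)) => kE; rewrite kE ltnn in kb.
rewrite -(big_mkord (fun k => (k < M)%N) F).
rewrite [LHS](big_nat_widen _ _ (maxn M (size b).+1)) ?leq_maxl//.
rewrite [RHS](big_nat_widen _ _ (maxn M (size b).+1)) ?leq_maxr//.
by apply: eq_bigl => k; rewrite andbC.
Qed.

Lemma wsum_wshift_ge phi g M b : (size b < M)%N ->
  wsum (fun c => (phi c : R[i]) * wshift c g b) M = fsmul phi g b.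
Proof.
move=> bM; rewrite wsum_wshift; apply: eq_bigl => k.
exact: leq_trans (ltn_ord k) bM.
Qed.

End word_shifts.

(** * Finite models of the left multi-shift inside [H] *)

Section finite_model.
Context (R : realType) (n : nat) (mu : weight R n) (H : hilbertType R).
Context (N : nat) (e : word n -> H) (eo : orthonormal_on (words_lt n N.+1) e).
Context (r C : R) (r0 : 0 <= r) (C0 : 0 <= C) (muC : forall i a, mu (i :: a) <= C).
Implicit Types (phi g : fps R n) (x y : H) (i : 'I_n).

Let wN := uniq_words_lt n N.
Let wN1 := uniq_words_lt n N.+1.

Let eoN : orthonormal_on (words_lt n N) e.
Proof.
by move=> a b; rewrite !mem_words_lt => aN bN; apply: eo; rewrite mem_words_lt ltnW.
Qed.

Let eoc i : orthonormal_on (words_lt n N) (fun a => e (i :: a)).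
Proof.
move=> a b; rewrite !mem_words_lt => aN bN; rewrite eo ?mem_words_lt//.
by rewrite eqseq_cons eqxx.
Qed.

(* The compression of [r L_Z] to the words of length at most N, carried to H
   by the orthonormal family [e]. *)
Definition fshift i x : H :=
  \sum_(a <- words_lt n N) ((r * mu (i :: a))%:C * inner x (e a)) *: e (i :: a).

Definition fshift_adj i x : H :=
  \sum_(a <- words_lt n N) ((r * mu (i :: a))%:C * inner x (e (i :: a))) *: e a.

Fact fshift_linear i : linear (fshift i).
Proof.
move=> c x y; rewrite /fshift scaler_sumr -big_split /=; apply: eq_bigr => a _.
by rewrite innerP mulrDr scalerDl scalerA mulrCA.
Qed.
HB.instance Definition _ i :=
  GRing.isLinear.Build R[i] H H _ (fshift i) (fshift_linear i).

Definition fshiftL i : {linear H -> H} := fshift i.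

Lemma adjoint_fshift i : adjoint (fshift i) = fshift_adj i.
Proof.
apply: adjoint_unique => x y; rewrite /fshift /fshift_adj inner_suml inner_sumr.
apply: eq_bigr => a _; rewrite innerZl innerZr [in RHS]rmorphM /= conj_real -innerC.
by rewrite mulrAC.
Qed.

Let rmu i a : normc (r * mu (i :: a))%:C <= r * C.
Proof.
by rewrite normc_real ger0_norm ?mulr_ge0 ?(ltW (weight_gt0 _ _))// ler_wpM2l.
Qed.

Let rC0 : 0 <= r * C. Proof. by rewrite mulr_ge0. Qed.

Lemma bounded_fshift i : bounded_op (fshiftL i).
Proof.
apply: le_lt_trans (opnorm_le rC0 _) (ltry _) => x.
rewrite -ler_sqr ?nnegrE ?mulr_ge0 ?rnorm_ge0//.
rewrite (sqr_rnorm_lincomb wN (@eoc i)) exprMn.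
apply: le_trans (ler_wpM2l (sqr_ge0 (r * C)) (bessel wN eoN x)).
rewrite mulr_sumr ler_sum// => a _; rewrite normcM exprMn ler_wpM2r ?sqr_ge0//.
by rewrite ler_sqr ?nnegrE ?normcge0.
Qed.

Lemma fshift_fshift_adj i x : fshift i (fshift_adj i x) =
  \sum_(a <- words_lt n N)
     ((r * mu (i :: a))%:C ^+ 2 * inner x (e (i :: a))) *: e (i :: a).
Proof.
rewrite /fshift /fshift_adj big_seq [RHS]big_seq; apply: eq_bigr => a aN.
by rewrite (inner_lincomb wN eoN)// mulrA -expr2.
Qed.

Lemma opnorm_row_fshift :
  (opnorm (fun x => \sum_i fshiftL i (adjoint (fshiftL i) x))%R <=
   ((r * C) ^+ 2)%:E)%E.
Proof.
apply: opnorm_le => [|x]; first exact: sqr_ge0.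
(* The row operator is diagonal in the family [e], with these eigenvalues; the empty word is in no
   range, hence the value 0. Summing over letters therefore does not enlarge the bound. *)
pose d (a : word n) : R[i] :=
  if a is i :: b then (r * mu (i :: b))%:C ^+ 2 else 0.
have -> : \sum_i fshiftL i (adjoint (fshiftL i) x) =
    \sum_(a <- words_lt n N.+1) (d a * inner x (e a)) *: e a.
  rewrite -[RHS](wsumE (fun a => (d a * inner x (e a)) *: e a)) wsumS.
  rewrite mul0r scale0r add0r; apply: eq_bigr => i _.
  by rewrite /= adjoint_fshift fshift_fshift_adj wsumE.
rewrite -ler_sqr ?nnegrE ?mulr_ge0 ?rnorm_ge0 ?sqr_ge0//.
rewrite (sqr_rnorm_lincomb wN1 eo) exprMn.
apply: le_trans (ler_wpM2l (sqr_ge0 ((r * C) ^+ 2)) (bessel wN1 eo x)).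
rewrite mulr_sumr ler_sum// => a _; rewrite normcM exprMn ler_wpM2r ?sqr_ge0//.
rewrite ler_sqr ?nnegrE ?normcge0 ?sqr_ge0//.
case: a => [|i a]; first by rewrite /d normc0 sqr_ge0.
by rewrite /d expr2 normcM -expr2 ler_sqr ?nnegrE ?normcge0.
Qed.

(** The monomial of [a] has norm [wprod mu a], so [e a] stands for the normalised monomial and
    truncated norms are preserved. *)
Definition fvec g : H :=
  \sum_(a <- words_lt n N.+1) ((wprod mu a)%:C * g a : R[i]) *: e a.

Lemma sqr_rnorm_fvec g : rnorm (fvec g) ^+ 2 = wsum (sqterm mu g) N.+1.
Proof.
rewrite (sqr_rnorm_lincomb wN1 eo) wsumE; apply: eq_bigr => a _.
by rewrite normcM normc_real ger0_norm ?(ltW (wprod_gt0 _ _))// exprMn.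
Qed.

Lemma eq_fvec f g : (forall a, (size a <= N)%N -> f a = g a) -> fvec f = fvec g.
Proof.
move=> fg; rewrite /fvec big_seq [RHS]big_seq; apply: eq_bigr => a.
by rewrite mem_words_lt => /fg ->.
Qed.

(** Both sides drop the coefficients of [g] of length [N]: [fshift] annihilates their vectors, and
    the shifted words are too long for [fvec]. *)
Lemma fshift_fvec i g : fshift i (fvec g) = r%:C *: fvec (fsmul (Zvar R i) g).
Proof.
rewrite /fvec -[X in _ = _ *: X](wsumE (fun a => ((wprod mu a)%:C * _) *: e a)) wsumS.
rewrite fsmul_Zvar mulr0 scale0r add0r (bigD1 i)//= [X in _ + X]big1 ?addr0; last first.
  move=> j ji; rewrite wsumE big1// => a _.
  by rewrite fsmul_Zvar (negPf ji) mul0r mulr0 scale0r.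
rewrite wsumE scaler_sumr /fshift big_seq [RHS]big_seq; apply: eq_bigr => a.
rewrite mem_words_lt => aN.
rewrite (inner_lincomb wN1 eo) ?mem_words_lt ?ltnS ?(ltnW aN)//.
rewrite fsmul_Zvar eqxx mul1r scalerA; congr (_ *: _).
by rewrite !rmorphM /= !mulrA.
Qed.

Lemma word_op_fvec c g :
  word_op fshiftL c (fvec g) = (r ^+ size c)%:C *: fvec (wshift c g).
Proof.
elim: c => [|i c ih]; first by rewrite expr0 scale1r.
rewrite -[LHS]/(fshiftL i (word_op fshiftL c (fvec g))) ih linearZ /=.
by rewrite fshift_fvec scalerA -rmorphM /= -exprSr.
Qed.

(** The series [phi(r Z)]. *)
Definition dilate phi : fps R n := fun c => (r ^+ size c)%:C * phi c.

Lemma wsum_word_op_fvec phi g M : (N < M)%N ->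
  wsum (fun c => phi c *: word_op fshiftL c (fvec g)) M =
  fvec (fsmul (dilate phi) g).
Proof.
move=> NM; transitivity (fvec (fun b => wsum (fun c =>
    (dilate phi c : R[i]) * wshift c g b) M)); last first.
  by apply: eq_fvec => b bN; rewrite wsum_wshift_ge// (leq_ltn_trans bN).
rewrite wsumE /fvec.
under eq_bigr do rewrite word_op_fvec scalerA /fvec scaler_sumr.
rewrite exchange_big /=; apply: eq_bigr => b _.
rewrite wsumE mulr_sumr scaler_suml; apply: eq_bigr => c _.
by rewrite scalerA /dilate; congr (_ *: _); rewrite mulrCA [phi c * _]mulrC.
Qed.

(** From [N.+1] on the partial sums at [fvec g] are stationary, so their distance to [S (fvec g)] is
    a constant bounded by a quantity tending to 0. *)
Lemma free_value_fvec phi (S : {linear H -> H}) g :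
  is_free_value phi fshiftL S -> S (fvec g) = fvec (fsmul (dilate phi) g).
Proof.
move=> [_ cS]; set x := fvec g.
pose D M := fun x => wsum (fun a => phi a *: word_op fshiftL a x) M - S x.
have word_opZ c z a : word_op fshiftL a (c *: z) = c *: word_op fshiftL a z.
  elim: a => //= i a ih; rewrite -[fshift i _]/(fshiftL i _) ih.
  by rewrite linearZ.
have DZ M c z : D M (c *: z) = c *: D M z.
  rewrite /D linearZ scalerBr !wsumE scaler_sumr; congr (_ - _).
  by apply: eq_bigr => a _; rewrite word_opZ scalerA mulrC -scalerA.
have DE M : (N < M)%N -> D M x = fvec (fsmul (dilate phi) g) - S x.
  by move=> NM; rewrite /D wsum_word_op_fvec.
apply/eqP; rewrite eq_sym -subr_eq0; apply/eqP/rnorm0_eq0.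
set d := rnorm _; apply/eqP; rewrite eq_le rnorm_ge0 andbT.
have key M : (N < M)%N -> (d%:E <= opnorm (D M) * (rnorm x)%:E)%E.
  by move=> NM; rewrite /d -(DE M)//; apply: rnorm_le_opnorm => c z; exact: DZ.
have [x0|x0] := eqVneq x 0.
  by have := key N.+1 (ltnSn N); rewrite x0 rnorm0 mule0.
have nx := rnorm_gt0 x0.
have : ((d / rnorm x)%:E <= 0)%E.
  apply: (cvge_to_ge cS); near=> M.
  rewrite EFinM lee_pdivrMr//; apply: key; near: M; exact: nbhs_infty_gt.
by rewrite lee_fin ler_pdivrMr// mul0r.
Unshelve. all: by end_near. Qed.

End finite_model.

(** * From the finite models to the multiplier bound *)

Section multiplier_bound.
Context (R : realType) (n : nat) (n_gt0 : (0 < n)%N) (mu : weight R n).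
Implicit Types (phi g : fps R n).

Lemma sqr_poweR12 (a : R) : 0 <= a -> ((a ^+ 2)%:E `^ 2^-1)%E = a%:E.
Proof.
by move=> a0; rewrite poweR12_sqrt ?lee_fin ?sqr_ge0//= sqrtr_sqr ger0_norm.
Qed.

Lemma poweR12_le (x y : \bar R) : (0 <= x)%E -> (x <= y)%E ->
  (x `^ 2^-1 <= y `^ 2^-1)%E.
Proof.
move=> x0 xy; apply: gt0_ler_poweR => //.
- by rewrite in_itv /= x0 leey.
- by rewrite in_itv /= (le_trans x0 xy) leey.
Qed.

(** [C] is the supremum of the weights, over a nonempty set because there is a letter. The
    eigenvalues of the row operator bound each squared weight by its norm. *)
Lemma weight_sup_le_tuple_norm : exists2 C : R, 0 < C &
  (forall i a, mu (i :: a) <= C) /\ (C%:E <= tuple_norm (LZ mu))%E.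
Proof.
pose A := [set x : R | exists i a, x = mu (i :: a)].
have [M HM] := weight_bounded mu.
have A0 : A (mu [:: Ordinal n_gt0]) by exists (Ordinal n_gt0), [::].
have supA : has_sup A.
  by split; [exists (mu [:: Ordinal n_gt0])|exists M => _ [i [a ->]]].
have muC i a : mu (i :: a) <= sup A by apply: ub_le_sup; [exact: supA.2|exists i, a].
have C0 : 0 < sup A by apply: lt_le_trans (weight_gt0 mu _) (muC (Ordinal n_gt0) [::]).
exists (sup A) => //; split=> //.
rewrite -(sqr_poweR12 (ltW C0)); apply: poweR12_le; first by rewrite lee_fin sqr_ge0.
have := @sqr_weight_le_opnorm _ _ mu; case: (opnorm _) => [u||] Ho.
- rewrite lee_fin.
  have u0 : 0 <= u.
    by apply: le_trans (sqr_ge0 (mu [:: Ordinal n_gt0])) _; rewrite -lee_fin Ho.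
  rewrite -(sqr_sqrtr u0) ler_sqr ?nnegrE ?sqrtr_ge0 ?(ltW C0)//.
  apply: ge_sup; first by case: supA.
  move=> _ [i [a ->]]; rewrite -ler_sqr ?nnegrE ?sqrtr_ge0 ?(ltW (weight_gt0 _ _))//.
  by rewrite sqr_sqrtr// -lee_fin Ho.
- by rewrite leey.
- by have := Ho (Ordinal n_gt0) [::].
Qed.

Lemma continuous_dilate phi g (s : seq (word n)) (r0 : R) :
  (fun r : R => \sum_(b <- s) sqterm mu (fsmul (dilate r phi) g) b) @ r0 -->
  \sum_(b <- s) sqterm mu (fsmul (dilate r0 phi) g) b.
Proof.
(* For real [r], the real and imaginary parts of each coefficient are polynomials in [r]. *)
pose p r := \sum_(b <- s) wprod mu b ^+ 2 *
  ((\sum_(k < (size b).+1) r ^+ k * complex.Re ((phi (take k b) : R[i]) * g (drop k b))) ^+ 2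
  + (\sum_(k < (size b).+1) r ^+ k * complex.Im ((phi (take k b) : R[i]) * g (drop k b))) ^+ 2).
have pE r : \sum_(b <- s) sqterm mu (fsmul (dilate r phi) g) b = p r.
  apply: eq_bigr => b _; rewrite /sqterm sqr_normc2; congr (_ * (_ ^+ 2 + _ ^+ 2)).
    rewrite /fsmul (raddf_sum (@complex.Re R : Rcomplex R -> R)); apply: eq_bigr => k _.
    have kb : (k <= size b)%N by rewrite -ltnS.
  rewrite /dilate size_takel// -mulrA.
    by case: ((phi _ : R[i]) * g _) => x y /=; rewrite mul0r subr0.
  rewrite /fsmul (raddf_sum (@complex.Im R : Rcomplex R -> R)); apply: eq_bigr => k _.
  have kb : (k <= size b)%N by rewrite -ltnS.
  rewrite /dilate size_takel// -mulrA.
  by case: ((phi _ : R[i]) * g _) => x y /=; rewrite mul0r addr0.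
under eq_fun do rewrite pE; rewrite pE {pE}/p.
have cs (T : Type) (l : seq T) (F : T -> R -> R) :
    (forall b, F b r @[r --> r0] --> F b r0) ->
    (\sum_(b <- l) F b r) @[r --> r0] --> \sum_(b <- l) F b r0.
  move=> cF; elim: l => [|b l ih].
    by rewrite big_nil; under eq_fun do rewrite big_nil; exact: cvg_cst.
  by rewrite big_cons; under eq_fun do rewrite big_cons; exact: cvgD.
have cp (c : nat -> R) K :
    (\sum_(k < K) r ^+ k * c k) @[r --> r0] --> \sum_(k < K) r0 ^+ k * c k.
  apply: cs => k; apply: cvgM; last exact: cvg_cst.
  exact: exprn_continuous.
apply: cs => b; apply: cvgM; first exact: cvg_cst.
have cRe := cp (fun k => complex.Re ((phi (take k b) : R[i]) * g (drop k b))) (size b).+1.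
have cIm := cp (fun k => complex.Im ((phi (take k b) : R[i]) * g (drop k b))) (size b).+1.
by apply: cvgD; rewrite expr2; (under eq_fun do rewrite expr2); exact: cvgM.
Qed.

Section free_bound.
Context (H : hilbertType R) (infH : infinite_dimensional H) (phi : fps R n).
Context (phi_hol : free_holomorphic phi (tuple_norm (LZ mu))).

Let M := free_sup H phi (tuple_norm (LZ mu)).
Context (phi_bnd : (M < +oo)%E).

Lemma fshift_op_ball N (e : word n -> H) (r : R) :
  orthonormal_on (words_lt n N.+1) e -> 0 < r < 1 ->
  op_ball (tuple_norm (LZ mu)) (fshiftL mu N e r).
Proof.
move=> eo /andP[r0 r1]; have [C C0 [muC CL]] := weight_sup_le_tuple_norm.
have rC0 : 0 <= r * C by rewrite mulr_ge0 ?ltW.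
split=> [i|]; first exact: (bounded_fshift eo (ltW r0) (ltW C0) muC i).
apply: lt_le_trans CL; apply: (@le_lt_trans _ _ (r * C)%:E); last first.
  by rewrite lte_fin gtr_pMl.
rewrite -(sqr_poweR12 rC0); apply: poweR12_le.
  apply: opnorm_ge0; apply: big1 => i _; rewrite adjoint_fshift.
  have -> : fshift_adj mu N e r i 0 = 0; last exact: linear0.
  by rewrite /fshift_adj big1// => a _; rewrite inner0l mulr0 scale0r.
exact: (opnorm_row_fshift eo (ltW r0) (ltW C0) muC).
Qed.

(** An empty supremum would be [-oo]; the model with [N = 0], the zero tuple, shows that the ball is
    not empty. *)
Lemma free_sup_ge0 : (0 <= M)%E.
Proof.
have [e eo] := exists_orthonormal (uniq_words_lt n 1) infH.
have r01 : 0 < (2^-1 : R) < 1 by rewrite invr_gt0 ltr0n invf_lt1 ?ltr1n.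
have Xball := fshift_op_ball eo r01; have [S phiS] := phi_hol Xball.
apply: (@le_trans _ _ (opnorm S)); first by apply: opnorm_ge0; exact: linear0.
by apply: ereal_sup_ubound; exists (fshiftL mu 0 e 2^-1), S.
Qed.

Let m := fine M.

Lemma free_supE : M = m%:E.
Proof. by rewrite /m fineK// ge0_fin_numE// free_sup_ge0. Qed.

(** [H] has room for an orthonormal family indexed by the words of length at most [N]; on its model,
    the value [S] of [phi] acts as truncated multiplication by [phi(r Z)]. *)
Lemma dilate_bound N (r : R) g : 0 < r < 1 ->
  wsum (sqterm mu (fsmul (dilate r phi) g)) N.+1 <=
     m ^+ 2 * wsum (sqterm mu g) N.+1.
Proof.
move=> r01; have [e eo] := exists_orthonormal (uniq_words_lt n N.+1) infH.
have Xball := fshift_op_ball eo r01; have [S phiS] := phi_hol Xball.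
have S_le : (opnorm S <= M)%E.
  by apply: ereal_sup_ubound; exists (fshiftL mu N e r), S.
rewrite -!(sqr_rnorm_fvec _ eo) -(free_value_fvec eo g phiS) -exprMn.
have m0 : 0 <= m by apply: fine_ge0; exact: free_sup_ge0.
rewrite ler_sqr ?nnegrE ?mulr_ge0 ?rnorm_ge0//.
rewrite -lee_fin EFinM -free_supE.
apply: (@le_trans _ _ (opnorm S * (rnorm (fvec mu N e g))%:E)%E).
  by apply: rnorm_le_opnorm => c x; rewrite linearZ.
by rewrite lee_wpmul2r// lee_fin rnorm_ge0.
Qed.

Lemma fsmul_wsum_bound N g :
  wsum (sqterm mu (fsmul phi g)) N <= m ^+ 2 * wsum (sqterm mu g) N.
Proof.
case: N => [|N]; first by rewrite /wsum !big_ord0 mulr0.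
have d1 : dilate 1 phi = phi.
  by apply/funext => c; rewrite /dilate expr1n mul1r.
(* The bound does not depend on [r] and only finitely many coefficients occur, so it survives the
   limit at 1 from the left. *)
have := cvg_at_left_filter (@continuous_dilate phi g (words_lt n N.+1) 1).
rewrite d1 wsumE => /cvgr_to_le; apply; near=> r.
rewrite -wsumE; apply: dilate_bound; apply/andP; split; near: r.
  by apply: nbhs_left_gt.
exact: nbhs_left_lt.
Unshelve. all: by end_near. Qed.

Lemma free_left_multiplier : left_multiplier mu phi.
Proof.
move=> g; apply/sqsumP.
apply: (@le_lt_trans _ _ (m ^+ 2 * rnorm g ^+ 2)%:E); last by rewrite ltry.
apply: esum_le_wsum => [a|N]; first exact: term_ge0.
apply: le_trans (fsmul_wsum_bound N g) _.
rewrite ler_wpM2l ?sqr_ge0// -lee_fin sqr_rnormF2.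
by apply: wsum_le_esum => a; exact: term_ge0.
Qed.

Lemma opnorm_Lmul_le : (opnorm (Lmul free_left_multiplier) <= M)%E.
Proof.
have m0 : 0 <= m by apply: fine_ge0; exact: free_sup_ge0.
rewrite free_supE; apply: opnorm_le => // g.
rewrite -ler_sqr ?nnegrE ?mulr_ge0 ?rnorm_ge0// -lee_fin sqr_rnormF2 exprMn.
apply: esum_le_wsum => [a|N]; first exact: term_ge0.
apply: le_trans (fsmul_wsum_bound N g) _.
rewrite ler_wpM2l ?sqr_ge0// -lee_fin sqr_rnormF2.
by apply: wsum_le_esum => a; exact: term_ge0.
Qed.

End free_bound.
End multiplier_bound.

(** * Multiplication by [phi] as the value of [phi] at the left shifts *)

Section functional_calculus.
Context (R : realType) (n : nat) (mu : weight R n) (phi : fps R n).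
Context (h : left_multiplier mu phi).
Implicit Types (g p : F2 mu).

Lemma F2_val_sum (T : Type) (s : seq T) (F : T -> F2 mu) w :
  F2_val (\sum_(a <- s) F a) w = \sum_(a <- s) F2_val (F a) w :> R[i]^o.
Proof.
elim: s => [|a s ih]; first by rewrite !big_nil.
by rewrite !big_cons -ih.
Qed.

Lemma F2_val_word_op a g : F2_val (word_op (LZ mu) a g) = wshift a g.
Proof. by elim: a => //= i a ->. Qed.

(** A word contributing to the coefficient at [w] is [w] with its suffix [b] removed, so length
    below [M] means that [w] is shorter than [M + size b]. *)
Lemma wsum_word_op_monomial b M :
  wsum (fun a => phi a *: word_op (LZ mu) a (monomialF2 mu b)) M =
  truncF2 mu (M + size b) (fsmul phi (monomial R b)).
Proof.
apply: val_inj; apply/funext => w; rewrite wsumE /=.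
rewrite F2_val_sum [RHS]/trunc.
transitivity (wsum (fun c => (phi c : R[i]) * wshift c (monomial R b) w) M).
  rewrite wsumE; apply: eq_bigr => c _; rewrite -[RHS]/((phi c : R[i]) * _).
  by rewrite -[wshift c (monomial R b)](F2_val_word_op c (monomialF2 mu b)).
rewrite wsum_wshift /fsmul big_mkcond; case: ifPn => wM.
  apply: eq_bigr => k _; case: ifPn => // kM; rewrite /monomial.
  case: eqP => [wb|]; last by rewrite mulr0.
  move: kM wM; rewrite -wb size_drop -leqNgt => Mk.
  by rewrite ltnNge (leq_trans (leq_add Mk (leqnn _)))// subnKC// -ltnS.
rewrite big1// => k _; case: ifPn => // kM; rewrite /monomial.
case: eqP => [wb|]; last by rewrite mulr0.
move: wM; rewrite -wb size_drop -leqNgt leqNgt => /negP[].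
by rewrite -[X in (X < _)%N](subnKC (leq_ord k)) ltn_add2r.
Qed.

Lemma monomial_expansion N p : vanishes_from N p ->
  p = \sum_(b <- words_lt n N) F2_val p b *: monomialF2 mu b.
Proof.
move=> pN; apply: val_inj; apply/funext => w /=; rewrite F2_val_sum.
have E b : F2_val (F2_val p b *: monomialF2 mu b) w =
  (F2_val p b : R[i]) * (w == b)%:R by [].
under eq_bigr do rewrite E.
have [wN|Nw] := ltnP (size w) N.
  rewrite (bigD1_seq w) ?mem_words_lt ?uniq_words_lt//= eqxx mulr1.
  by rewrite big1 ?addr0// => b bw; rewrite eq_sym (negPf bw) mulr0.
rewrite pN// big_seq big1// => b; rewrite mem_words_lt => bN.
case: eqP => [wb|]; last by rewrite mulr0.
by rewrite wb leqNgt bN in Nw.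
Qed.

Lemma word_op_lincomb (V : lmodType R[i]) (X : 'I_n -> {linear V -> V}) a
    (s : seq (word n)) (c : word n -> R[i]) (x : word n -> V) :
  word_op X a (\sum_(b <- s) c b *: x b) =
  \sum_(b <- s) c b *: word_op X a (x b).
Proof.
elim: a => //= i a ->; rewrite linear_sum; apply: eq_bigr => b _.
exact: linearZ.
Qed.

Lemma Lmul_is_LZ_value : (opnorm (Lmul h) < +oo)%E -> is_LZ_value phi (Lmul h).
Proof.
move=> hfin; split=> // N p pN.
have /= := monomial_expansion pN; set c := F2_val p => pE.
have -> : wsum (fun a => phi a *: word_op (LZ mu) a p) = fun M =>
    \sum_(b <- words_lt n N) c b *: truncF2 mu (M + size b) (Lmul h (monomialF2 mu b)).
  apply/funext => M; rewrite wsumE.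
  have W a : word_op (LZ mu) a p =
      \sum_(b <- words_lt n N) c b *: word_op (LZ mu) a (monomialF2 mu b).
    by rewrite {1}pE; exact: word_op_lincomb.
  under eq_bigr do rewrite W scaler_sumr.
  rewrite exchange_big; apply: eq_bigr => b _.
  rewrite -wsum_word_op_monomial wsumE scaler_sumr; apply: eq_bigr => a _.
  by rewrite !scalerA mulrC.
have -> : Lmul h p = \sum_(b <- words_lt n N) c b *: Lmul h (monomialF2 mu b).
  by rewrite pE linear_sum; apply: eq_bigr => b _; rewrite linearZ.
elim: (words_lt n N) => [|b s ih].
  by rewrite big_nil; under eq_fun do rewrite big_nil; exact: cvg_cst.
rewrite big_cons; under eq_fun do rewrite big_cons.
apply: cvgD ih; apply: cvgZl_tmp.
(* The truncation index exceeds [M] by the fixed [size b], which does not affect the limit. *)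
rewrite (cvg_shiftn (size b) (fun M => truncF2 mu M (Lmul h (monomialF2 mu b)))).
exact: truncF2_cvg.
Qed.

End functional_calculus.

Theorem theorem4p7 (R : realType) (n : nat) (n_gt0 : (0 < n)%N)
    (mu : weight R n) :
  [/\ eval_domain mu = [set lam | (kernel_sum mu lam < +oo)%E] /\
      [set lam | (kernel_sum mu lam < +oo)%E] =
        joint_point_spectrum (fun i => adjoint (LZ mu i)),
      forall (lam : 'rV[R[i]]_n) (Phi : {linear F2 mu -> R[i]^o}) (f : F2 mu),
        extends_eval lam Phi ->
        [/\ (\esum_(a in [set: word n])
               (normc (F2_val f a * word_val lam a))%:E < +oo)%E,
            eval_sum f lam @ \oo --> Phi f,
            fps_eval lam f = Phi f
          & ((normc (fps_eval lam f))%:E <=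
             (complex.Re `|f|)%:E * kernel_sum mu lam `^ 2^-1)%E],
      forall lam : 'rV[R[i]]_n,
        (forall f : F2 mu, cvgn (eval_sum f lam)) -> eval_domain mu lam
    & forall H : hilbertType R, separable_space H -> infinite_dimensional H ->
      forall phi : fps R n,
        free_holomorphic phi (tuple_norm (LZ mu)) ->
        (free_sup H phi (tuple_norm (LZ mu)) < +oo)%E ->
        exists (h : left_multiplier mu phi) (T : {linear F2 mu -> F2 mu}),
          [/\ is_LZ_value phi T,
              opnorm (Lmul h) = opnorm T
            & (opnorm T <= free_sup H phi (tuple_norm (LZ mu)))%E]].
Proof.
split.
- split.
    by apply/seteqP; split=> lam; rewrite eval_domainE.
  by apply/seteqP; split=> lam /=; rewrite spectrum_kernel_sum.
- move=> lam Phi f PhiP; have kfin := extends_kernel_sum PhiP.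
  have fE : fps_eval lam f = Phi f.
    exact: (cvg_lim (@norm_hausdorff _ R[i]^o) (@eval_sum_cvg _ _ _ _ _ PhiP f)).
  split=> //; [exact: eval_abs_summable|exact: eval_sum_cvg|].
  have -> : fps_eval lam f = inner f (kernelF2 kfin).
    exact: (cvg_lim (@norm_hausdorff _ R[i]^o) (@eval_functional_cvg _ _ _ _ kfin f)).
  by rewrite (rnorm_kernelF2 kfin) -EFinM lee_fin; exact: cauchy_schwarz.
- move=> lam cvf; apply/eval_domainE; exact: cvg_eval_kernel_sum cvf.
- move=> H _ infH phi hol bnd.
  (* Multiplication by [phi] itself serves as [phi(L_Z)], so the equality of norms is immediate. *)
  exists (free_left_multiplier n_gt0 infH hol bnd).
  exists (Lmul (free_left_multiplier n_gt0 infH hol bnd)).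
  have le := opnorm_Lmul_le n_gt0 infH hol bnd.
  by split=> //; apply: Lmul_is_LZ_value; exact: le_lt_trans le bnd.
Qed.
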